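(* Let $Z_+:\mathcal H(\Lambda)\to\mathcal H(\Lambda)$ be the forward shift operator on the space of DA functions on $\Lambda$ with values in a complex vector space $\mathcal V$. The kernel and range of $Z_+$ can be characterized as follows: $$\ker(Z_+)=\{0\},\qquad \operatorname{ran}(Z_+)=\{f\in\mathcal H(\Lambda): f(0)=0\}.$$
   Context: Rhombic lattice: $\Lambda$ is a monohedral (edge-to-edge) tessellation of $\mathbb C$ by mutually congruent (nondegenerate) rhombi of side length 1, viewed as a planar graph with vertex set $\mathbf V(\Lambda)$, (undirected) edge set $\mathbf E(\Lambda)$ and face set $\mathbf F(\Lambda)$ (the rhombi). $\hat{\mathbf E}(\Lambda)=\{b-a:(a,b)\in\mathbf E(\Lambda)\}$ is the set of edge directions; it is finite and closed under $e\mapsto -e$. A path from $a$ to $b$ is a finite sequence $(z_0=a,z_1,\dots,z_N=b)$ of vertices with consecutive ones adjacent; it is closed if $a=b$. Standing assumptions: $0\in\mathbf V(\Lambda)$; $1\in\hat{\mathbf E}(\Lambda)$; and both sides of every track $F$ in $\Lambda$ contain tracks that are coherent to $F$. Here a track is a sequence $(F_n)_{n\in\mathbb Z}$ of faces such that for every $n$ the faces $F_n,F_{n+1}$ are adjacent and the edges shared by $F_n$ with $F_{n+1}$ and with $F_{n-1}$ are two opposite sides of $F_n$; these shared edges are the ties of the track. The sides of a track are the two connected components of the graph obtained by deleting all ties of the track from $\mathbf E(\Lambda)$. Two tracks are coherent if their ties are parallel. DA functions: for $f:\mathbf V(\Lambda)\to\mathcal V$ and a path $\gamma=(z_0,\dots,z_N)$,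 $\int_\gamma f\,\delta z=\sum_{n=1}^N\frac{f(z_{n-1})+f(z_n)}{2}(z_n-z_{n-1})$. $f$ is discrete analytic (DA) if $\int_\gamma f\,\delta z=0$ for every closed path $\gamma$; $\int_a^b f\,\delta z$ denotes the then path-independent integral along any path from $a$ to $b$. $\mathcal H(\Lambda)$ is the space of DA functions. The forward shift operator is $(Z_+f)(z)=\frac{f(0)-f(z)}{2}+\int_0^z f\,\delta z$ (it maps DA functions to DA functions). *)

(* Defs.v *)
From mathcomp Require Import all_boot all_order all_algebra.
From mathcomp Require Import boolp classical_sets reals.
From mathcomp Require Export complex.

Set Implicit Arguments.
Unset Strict Implicit.
Unset Printing Implicit Defensive.

Import Order.TTheory GRing.Theory Num.Theory.
Local Open Scope classical_set_scope.
Local Open Scope ring_scope.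
Local Open Scope complex_scope.

Section RhombicLattices.
Variable R : realType.
Implicit Types (a b c d u v z w : R[i]) (A B : set R[i]).

Definition segment a b : set R[i] :=
  [set z | exists2 t : R, 0 <= t <= 1 & z = a + t%:C * (b - a)].

Definition parallelogram a u v : set R[i] :=
  [set z | exists s t : R,
     [/\ 0 <= s <= 1, 0 <= t <= 1 & z = a + s%:C * u + t%:C * v]].

(* [A] is a nondegenerate closed rhombus of side length 1 which has [a] as a
   corner and [u], [v] as the two side vectors at that corner.  A given rhombus
   satisfies this for each of its four corners and both orders of [u], [v]. *)
Definition unit_rhombus_at a u v A : Prop :=
  [/\ `|u| = 1, `|v| = 1, v != u, v != - u & A = parallelogram a u v].

Definition unit_rhombus A : Prop := exists a u v, unit_rhombus_at a u v A.

Definition corner A a : Prop := exists u v, unit_rhombus_at a u v A.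

(* Symmetric in [a] and [b]: sides are not oriented. *)
Definition side A a b : Prop := exists v, unit_rhombus_at a (b - a) v A.

Definition opposite_sides A a b c d : Prop :=
  unit_rhombus_at a (b - a) (c - a) A /\ d = c + (b - a).

Definition congruent A B : Prop :=
  exists2 phi : R[i] -> R[i],
    (forall z w, `|phi z - phi w| = `|z - w|) & phi @` A = B.

(* A lattice is given by its set of faces, each face being a closed subset of
   the plane.  The last clause (edge-to-edge) also says that the interiors of
   distinct faces are disjoint. *)
Definition rhombic_lattice (L : set (set R[i])) : Prop :=
  [/\ forall A, L A -> unit_rhombus A,
      forall A B, L A -> L B -> congruent A B,
      \bigcup_(A in L) A = setT
    & forall A B, L A -> L B -> A <> B ->
        [\/ A `&` B = set0,
            exists a, [/\ corner A a, corner B a & A `&` B = [set a]]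
          | exists a b, [/\ side A a b, side B a b & A `&` B = segment a b]]].

Section Graph.
Variable L : set (set R[i]).

Definition vertices : set R[i] := [set a | exists2 A, L A & corner A a].

Definition edge a b : Prop := exists2 A, L A & side A a b.

Definition edge_directions : set R[i] :=
  [set e | exists a b, edge a b /\ e = b - a].

(* The second clause, together with the shared sides in the third one, says
   that consecutive faces are adjacent. *)
Definition track (F : int -> set R[i]) : Prop :=
  [/\ forall n, L (F n),
      forall n, F n <> F (n + 1)
    & forall n, exists a b c d,
        [/\ opposite_sides (F n) a b c d,
            side (F (n - 1)) a b & side (F (n + 1)) c d]].

Definition tie (F : int -> set R[i]) a b : Prop :=
  exists n, side (F n) a b /\ side (F (n + 1)) a b.

(* [(a :: p)] is a path from [a] to [b] that uses only edges [(x, y)] for which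
   [e x y] holds. *)
Definition path_from_to (e : vertices -> vertices -> Prop)
    (a : vertices) (p : seq vertices) (b : vertices) : Prop :=
  path (fun x y => `[< e x y >]) a p /\ last a p = b.

Definition adjacent (x y : vertices) : Prop := edge (val x) (val y).

Definition adjacent_off_ties F (x y : vertices) : Prop :=
  adjacent x y /\ ~ tie F (val x) (val y).

Definition track_side (F : int -> set R[i]) (S : set vertices) : Prop :=
  exists a : vertices, S = [set b | exists p, path_from_to (adjacent_off_ties F) a p b].

Definition contains_track (S : set vertices) (G : int -> set R[i]) : Prop :=
  forall n (x : vertices), corner (G n) (val x) -> S x.

Definition coherent (F G : int -> set R[i]) : Prop :=
  forall a b c d, tie F a b -> tie G c d ->
    exists k : R, d - c = k%:C * (b - a).

Definition coherent_tracks_on_both_sides : Prop :=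
  forall F, track F -> forall S, track_side F S ->
    exists G, [/\ track G, coherent F G & contains_track S G].

Section Functions.
Variable V : lmodType R[i].
Implicit Type f : vertices -> V.

Fixpoint path_integral f (a : vertices) (p : seq vertices) : V :=
  if p is b :: q
  then (val b - val a) *: (2^-1 *: (f a + f b)) + path_integral f b q
  else 0.

Definition discrete_analytic f : Prop :=
  forall (a : vertices) (p : seq vertices),
    path_from_to adjacent a p a -> path_integral f a p = 0.

Definition DA_functions : set (vertices -> V) := [set f | discrete_analytic f].

(* The integral of [f] along some path from [a] to [b]; for discrete analytic
   [f] it does not depend on the path. *)
Definition integral f (a b : vertices) : V :=
  xget 0 [set I | exists2 p, path_from_to adjacent a p b
                           & I = path_integral f a p].

Definition forward_shift (o : vertices) f : vertices -> V :=
  fun z : vertices => 2^-1 *: (f o - f z) + integral f o z.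

End Functions.
End Graph.
End RhombicLattices.

(* Main.v *)
Require Import Defs.
From mathcomp Require Import all_boot all_order all_algebra.
From mathcomp Require Import boolp classical_sets reals.
From mathcomp Require Import topology normedtype.
From mathcomp Require Import zify ring lra.

(* Along an edge (a, b) with e = b - a, the equation Z_+ f = g (where g(0) = 0)
   reads (1 + e) f(a) - (1 - e) f(b) = 2 (g(b) - g(a)), and every solution f is
   discrete analytic since g + f / 2 is a primitive of it.  For e = 1 the
   equation gives f(a) = g(a + 1) - g(a) at the left ends of horizontal unit
   edges; along the other edges it transports the value of f.

   Every vertex is joined to a left end by edges other than +-1.  Indeed, let h
   be the integer-valued function that increases by one along each edge 1 and is
   constant along the other edges, and interpolate it to the plane: it is
   nondecreasing on horizontal lines.  Tracks with ties +-1 have constant level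
   and, the faces being congruent, cross every horizontal line, so there is only
   one track for each level, and coherent tracks provide one at every level.
   Walking horizontally from a vertex of level n to the track of level n stays
   on level n.

   Transport is path independent: with l e in place of e, 0 < l < 1, it is
   invertible along every edge and commutes around each rhombus, so it has no
   holonomy because the lattice is simply connected; since it is rational in l,
   this persists at l = 1 for paths without edges +-1.  Simple connectedness is
   obtained from a Lebesgue number r of the cover by stars of faces: transport
   between points at distance < r is well defined, and composing through
   midpoints repeatedly doubles this scale. *)

Set Implicit Arguments.
Unset Strict Implicit.
Unset Printing Implicit Defensive.
Import Order.TTheory GRing.Theory Num.Theory.
Import numFieldNormedType.Exports.
Local Open Scope classical_set_scope.
Local Open Scope ring_scope.
Local Open Scope complex_scope.

(* [Num.Theory] rebinds [Re] and [Im] to functions with values in [R[i]]. *)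
Local Notation Re := (@complex.Re _).
Local Notation Im := (@complex.Im _).

(** * Unit rhombi *)

(* Makes the equation [e] multiplied by [c] available to [lra]. *)
Ltac mulby e c := move: (congr1 (fun zz => zz * c) e); cbv beta.

Section Rhombi.
Variable R : realType.
Implicit Types (a b c d u v w x y z p q : R[i]) (A B : set R[i]) (s t : R).

Lemma ReD z w : Re (z + w) = Re z + Re w. Proof. by case: z; case: w. Qed.
Lemma ImD z w : Im (z + w) = Im z + Im w. Proof. by case: z; case: w. Qed.
Lemma ReN z : Re (- z) = - Re z. Proof. by case: z. Qed.
Lemma ImN z : Im (- z) = - Im z. Proof. by case: z. Qed.
Lemma ReZ s z : Re (s%:C * z) = s * Re z.
Proof. by case: z => x y; rewrite /= mul0r subr0. Qed.
Lemma ImZ s z : Im (s%:C * z) = s * Im z.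
Proof. by case: z => x y; rewrite /= mul0r addr0. Qed.
Definition reimE := (ReD, ImD, ReN, ImN, ReZ, ImZ).

Lemma eqcP z w : Re z = Re w -> Im z = Im w -> z = w.
Proof. by case: z => ? ?; case: w => ? ? /= -> ->. Qed.

Lemma norm_sqr z (r : R) : `|z| = r%:C -> Re z ^+ 2 + Im z ^+ 2 = r ^+ 2.
Proof.
case: z => x y; rewrite normc_def /= => -[] <-.
by rewrite sqr_sqrtr // addr_ge0 ?sqr_ge0.
Qed.

Lemma norm1P z : `|z| = 1 <-> Re z ^+ 2 + Im z ^+ 2 = 1.
Proof.
split=> [h|h]; first by rewrite (@norm_sqr z 1) ?h ?expr1n.
by case: z h => x y /= h; rewrite normc_def /= h sqrtr1.
Qed.

Definition cross u v : R := Re u * Im v - Im u * Re v.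

Definition pt a u v s t : R[i] := a + s%:C * u + t%:C * v.

Lemma pt_inj a u v s t s' t' : cross u v != 0 ->
  pt a u v s t = pt a u v s' t' -> s = s' /\ t = t'.
Proof.
rewrite /cross /pt => D0 e.
have eR := congr1 (@complex.Re R) e; have eI := congr1 (@complex.Im R) e.
rewrite !reimE in eR eI.
have h1 : (s - s') * (Re u * Im v - Im u * Re v) = 0 by mulby eR (Im v); mulby eI (Re v); lra.
have h2 : (t - t') * (Re u * Im v - Im u * Re v) = 0 by mulby eR (Im u); mulby eI (Re u); lra.
by move/eqP: h1; move/eqP: h2; rewrite !mulf_eq0 (negbTE D0) !orbF !subr_eq0;
  move=> /eqP -> /eqP ->.
Qed.

(** If the determinant vanishes, [v] is [k] times [u] with [k] the inner product, and equality of
    the norms forces [k] to be 1 or -1. *)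
Lemma cross_neq0 u v : `|u| = 1 -> `|v| = 1 -> v != u -> v != - u ->
  cross u v != 0.
Proof.
move=> /norm1P nu /norm1P nv vu vNu; apply/eqP => D0.
rewrite /cross in D0.
set k := Re u * Re v + Im u * Im v.
have vR : Re v = k * Re u by rewrite /k; mulby nu (Re v); mulby D0 (Im u); lra.
have vI : Im v = k * Im u by rewrite /k; mulby nu (Im v); mulby D0 (Re u); lra.
have : (k - 1) * (k + 1) = 0.
  have : k ^+ 2 = 1 by move: nv; rewrite vR vI => nv; mulby nu (k ^+ 2); lra.
  by move=> k2; lra.
move/eqP; rewrite mulf_eq0 => /orP[/eqP k1|/eqP k1].
  have k1' : k = 1 by lra.
  by move/eqP: vu; apply; apply: eqcP; rewrite (vR, vI) k1' mul1r.
have k1' : k = -1 by lra.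
by move/eqP: vNu; apply; apply: eqcP; rewrite (vR, vI) k1' mulN1r reimE.
Qed.

Section OneRhombus.
Variables (a u v : R[i]) (A : set R[i]).
Hypothesis hA : unit_rhombus_at a u v A.

Lemma rh_nu : `|u| = 1. Proof. by case: hA. Qed.
Lemma rh_nv : `|v| = 1. Proof. by case: hA. Qed.
Lemma rh_cross : cross u v != 0.
Proof. by case: hA => *; apply: cross_neq0. Qed.
Lemma rhP z : A z <-> exists s t, [/\ 0 <= s <= 1, 0 <= t <= 1 & z = pt a u v s t].
Proof. by case: hA => _ _ _ _ ->. Qed.
Lemma rh_pt s t : 0 <= s <= 1 -> 0 <= t <= 1 -> A (pt a u v s t).
Proof. by move=> hs ht; apply/rhP; exists s, t. Qed.
Lemma rh_ptE s t : A (pt a u v s t) -> 0 <= s <= 1 /\ 0 <= t <= 1.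
Proof. by move=> /rhP[s' [t' [hs ht /(pt_inj rh_cross)[-> ->]]]]. Qed.

Lemma rh_swap : unit_rhombus_at a v u A.
Proof.
case: hA => nu nv vu vNu AE; split => //; first by rewrite eq_sym.
  by apply: contra vNu => /eqP ->; rewrite opprK.
rewrite AE; apply/seteqP; split=> z [s [t [hs ht ->]]]; exists t, s; split=> //;
 by rewrite addrAC.
Qed.

Lemma rh_flip : unit_rhombus_at (a + u) (- u) v A.
Proof.
case: hA => nu nv vu vNu AE; split; rewrite ?normrN ?opprK //.
rewrite AE; apply/seteqP; split=> z [s [t [hs ht ->]]]; exists (1 - s), t;
 split=> //; [lra|by apply: eqcP; rewrite !reimE; ring|lra|by apply: eqcP; rewrite !reimE; ring].
Qed.
End OneRhombus.

Lemma rh_sym (P : R[i] -> R[i] -> R[i] -> Prop) A :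
  (forall a u v, unit_rhombus_at a u v A -> P a u v -> P a v u) ->
  (forall a u v, unit_rhombus_at a u v A -> P a u v -> P (a + u) (- u) v) ->
  forall a u v, unit_rhombus_at a u v A -> P a u v ->
  [/\ P a u v, P (a + u) (- u) v, P (a + v) u (- v) & P (a + u + v) (- u) (- v)].
Proof.
move=> sw fl a u v hA h.
have fl' b x y : unit_rhombus_at b x y A -> P b x y -> P (b + y) x (- y).
  move=> hb h1; apply: (sw _ _ _ (rh_flip (rh_swap hb))).
  by apply: fl (rh_swap hb) _; apply: sw h1.
split=> //; [exact: fl|exact: fl'|].
by apply: fl' (fl _ _ _ hA h); apply: rh_flip.
Qed.

Lemma corner_rh a u v A : unit_rhombus_at a u v A ->
  [/\ corner A a, corner A (a + u), corner A (a + v) & corner A (a + u + v)].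
Proof.
move=> hA; apply: (@rh_sym (fun a _ _ => corner A a) A) (hA) _ => //.
- by move=> b x y hb _; exists (- x), y; apply: rh_flip.
- by exists u, v.
Qed.

Lemma corner_in A x : corner A x -> A x.
Proof.
move=> [u [v h]]; have -> : x = pt x u v 0 0.
  by apply: eqcP; rewrite /pt !reimE; ring.
by apply: (rh_pt h); lra.
Qed.

(** Extremality involves only the point set [A], so it locates the corners of one representation in
    the coordinates of another. *)
Lemma corner_extreme A x p q : corner A x -> A p -> A q -> p + q = x + x -> p = x.
Proof.
move=> [u [v h]] /(rhP h)[s [t [hs ht pE]]] /(rhP h)[s' [t' [hs' ht' qE]]] e.
have := @pt_inj (x + x) u v (s + s') (t + t') 0 0 (rh_cross h).
case=> [|e1 e2].
  apply/esym; transitivity (p + q).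
    by rewrite e; apply: eqcP; rewrite /pt !reimE; ring.
  by rewrite pE qE; apply: eqcP; rewrite /pt !reimE; ring.
have s0 : s = 0 by lra.
have t0 : t = 0 by lra.
by rewrite pE s0 t0; apply: eqcP; rewrite /pt !reimE; ring.
Qed.

Lemma corner_coord a u v A s t : unit_rhombus_at a u v A ->
  corner A (pt a u v s t) -> (s = 0 \/ s = 1) /\ (t = 0 \/ t = 1).
Proof.
move=> h hc; have [hs ht] := rh_ptE h (corner_in hc).
have D := rh_cross h.
split.
  have [s0|s0] := eqVneq s 0; [by left|right].
  have [//|s1] := eqVneq s 1.
  (* Moving by [e] in both directions stays in the rhombus, so the point is not extreme. *)
  pose e := Num.min s (1 - s).
  have e0 : 0 < e by rewrite /e lt_min; apply/andP; split; lra.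
  have es : e <= s by rewrite /e ge_min lexx.
  have es1 : e <= 1 - s by rewrite /e ge_min lexx orbT.
  have h1 : A (pt a u v (s + e) t) by apply: (rh_pt h) => //; lra.
  have h2 : A (pt a u v (s - e) t) by apply: (rh_pt h) => //; lra.
  have := corner_extreme hc h1 h2.
  case/(_ _)/(pt_inj D); last by lra.
  by apply: eqcP; rewrite /pt !reimE; ring.
have [s0|s0] := eqVneq t 0; [by left|right].
have [//|s1] := eqVneq t 1.
pose e := Num.min t (1 - t).
have e0 : 0 < e by rewrite /e lt_min; apply/andP; split; lra.
have es : e <= t by rewrite /e ge_min lexx.
have es1 : e <= 1 - t by rewrite /e ge_min lexx orbT.
have h1 : A (pt a u v s (t + e)) by apply: (rh_pt h) => //; lra.
have h2 : A (pt a u v s (t - e)) by apply: (rh_pt h) => //; lra.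
have := corner_extreme hc h1 h2.
case/(_ _)/(pt_inj D); last by lra.
by apply: eqcP; rewrite /pt !reimE; ring.
Qed.

Lemma pt00 a u v : pt a u v 0 0 = a. Proof. by rewrite /pt !mul0r !addr0. Qed.
Lemma pt10 a u v : pt a u v 1 0 = a + u. Proof. by rewrite /pt !mul0r addr0 mul1r. Qed.
Lemma pt01 a u v : pt a u v 0 1 = a + v. Proof. by rewrite /pt mul0r addr0 mul1r. Qed.
Lemma pt11 a u v : pt a u v 1 1 = a + u + v. Proof. by rewrite /pt !mul1r. Qed.

Lemma corner4 a u v A x : unit_rhombus_at a u v A -> corner A x ->
  [\/ x = a, x = a + u, x = a + v | x = a + u + v].
Proof.
move=> h hc; have /(rhP h)[s [t [hs ht xE]]] := corner_in hc.
move: hc; rewrite xE => hc.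
by case: (corner_coord h hc) => -[->|->] [->|->]; rewrite ?(pt00, pt01, pt10, pt11);
 [constructor 1|constructor 3|constructor 2|constructor 4].
Qed.

(** In [rh_uniq] the rows are the coordinates of [u'] and [v'] with respect to [u] and [v]. Since
    [u'], [v'] and [u' + v'] all lead to corners, entries and column sums are 0 or 1; an invertible
    matrix of this kind is a permutation matrix. *)
Lemma unimodular01 (s1 t1 s2 t2 : R) : s1 = 0 \/ s1 = 1 -> t1 = 0 \/ t1 = 1 ->
  s2 = 0 \/ s2 = 1 -> t2 = 0 \/ t2 = 1 -> s1 + s2 = 0 \/ s1 + s2 = 1 ->
  t1 + t2 = 0 \/ t1 + t2 = 1 -> s1 * t2 - t1 * s2 <> 0 ->
  (s1 = 1 /\ t1 = 0 /\ s2 = 0 /\ t2 = 1) \/ (s1 = 0 /\ t1 = 1 /\ s2 = 1 /\ t2 = 0).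
Proof.
move=> [] -> [] -> [] -> [] -> h h' D; first [by left|by right|exfalso].
all: first [by case: h; lra|by case: h'; lra|by case: D; ring].
Qed.

Lemma rh_uniq a u v u' v' A : unit_rhombus_at a u v A -> unit_rhombus_at a u' v' A ->
  (u' = u /\ v' = v) \/ (u' = v /\ v' = u).
Proof.
move=> h h'.
have coords w : corner A (a + w) -> exists s t, [/\ s = 0 \/ s = 1, t = 0 \/ t = 1 &
   w = s%:C * u + t%:C * v].
  move=> hc; have /(rhP h)[s [t [_ _ wE]]] := corner_in hc.
  have [] := @corner_coord a u v A s t h; first by rewrite -wE.
  move=> hs ht; exists s, t; split=> //; apply: (@addrI _ a); rewrite wE /pt.
  by rewrite addrA.
have [_ c1 c2 c3] := corner_rh h'.
have [s1 [t1 [hs1 ht1 e1]]] := coords _ c1.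
have [s2 [t2 [hs2 ht2 e2]]] := coords _ c2.
rewrite -addrA in c3.
have [s3 [t3 [hs3 ht3 e3]]] := coords _ c3.
have [e4 e5] : s1 + s2 = s3 /\ t1 + t2 = t3.
  apply: (@pt_inj 0 u v _ _ _ _ (rh_cross h)).
  rewrite /pt !add0r -e3 e1 e2; apply: eqcP; rewrite !reimE; ring.
have D : cross u' v' != 0 := rh_cross h'.
have DE : cross u' v' = (s1 * t2 - t1 * s2) * cross u v.
  by rewrite /cross e1 e2 !reimE; ring.
have : s1 * t2 - t1 * s2 != 0 by apply: contraNneq D => D0; rewrite DE D0 mul0r.
move=> /eqP D'.
have [[s10 [t10 [s20 t20]]]|[s10 [t10 [s20 t20]]]] :
  (s1 = 1 /\ t1 = 0 /\ s2 = 0 /\ t2 = 1) \/ (s1 = 0 /\ t1 = 1 /\ s2 = 1 /\ t2 = 0).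
- by apply: unimodular01 D'; rewrite ?e4 ?e5.
- by left; rewrite e1 e2 s10 t10 s20 t20 !mul1r !mul0r addr0 add0r.
- by right; rewrite e1 e2 s10 t10 s20 t20 !mul1r !mul0r addr0 add0r.
Qed.

(* The representations of a rhombus are related by swapping the two side
   vectors and by moving to a neighbouring corner. *)
Lemma rh_ind (P : R[i] -> R[i] -> R[i] -> Prop) A :
  (forall a u v, unit_rhombus_at a u v A -> P a u v -> P a v u) ->
  (forall a u v, unit_rhombus_at a u v A -> P a u v -> P (a + u) (- u) v) ->
  forall a u v a' u' v', unit_rhombus_at a u v A -> unit_rhombus_at a' u' v' A ->
  P a u v -> P a' u' v'.
Proof.
move=> sw fl a u v a' u' v' h h' Pa.
have hc : corner A a' by exists u', v'.
have [x [y [hx Px]]] : exists x y, unit_rhombus_at a' x y A /\ P a' x y.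
  have [||r1 r2 r3 r4] :=
    @rh_sym (fun b x y => unit_rhombus_at b x y A /\ P b x y) A _ _ a u v h (conj h Pa).
  - by move=> b x y hb [_ Pb]; split; [apply: rh_swap|apply: sw].
  - by move=> b x y hb [_ Pb]; split; [apply: rh_flip|apply: fl].
  by case: (corner4 h hc) => ->; [exists u, v|exists (- u), v|exists u, (- v)|exists (- u), (- v)].
by case: (rh_uniq hx h') => -[-> ->] //; apply: sw Px.
Qed.

End Rhombi.

(** * Uniform thresholds on compact boxes *)

Section Compactness.
Variable R : realType.
Implicit Types (p q z w : R[i]) (r d : R).

(** Distance in the supremum norm, written as linear inequalities that [lra] can use. *)
Definition sup_close r p q : Prop :=
  - r < Re p - Re q < r /\ - r < Im p - Im q < r.

Definition box (x0 x1 y0 y1 : R) z : Prop := x0 <= Re z <= x1 /\ y0 <= Im z <= y1.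

(** Compactness in its covering form, with [r] running through the right neighbourhoods of 0. This
    is why the local hypothesis asks for all small [r]. *)
Lemma box_uniform (x0 x1 y0 y1 : R) (P : R[i] -> R -> Prop) :
  (forall z, box x0 x1 y0 y1 z -> exists2 d, 0 < d &
     forall w r, sup_close d z w -> 0 < r < d -> P w r) ->
  exists2 r, 0 < r & forall z, box x0 x1 y0 y1 z -> P z r.
Proof.
move=> loc.
have cK : compact (`[x0, x1]%classic `*` `[y0, y1]%classic).
  by apply: compact_setX; apply: segment_compact.
have /compact_near_coveringP := cK.
move=> /(_ R (0^'+) (fun r xy => P (xy.1 +i* xy.2) r) _).
case.
- move=> [x y] [/= hx hy].
  have [|d d0 hd] := loc (x +i* y).
    by move: hx hy; rewrite /= !in_itv /=; split.
  exists (ball (x, y) d, [set r | 0 < r < d]) => /=.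
    split; first exact: nbhsx_ballx.
    near=> r; apply/andP; split; near: r; [exact: nbhs_right_gt|exact: nbhs_right_lt].
  move=> [[x' y'] r] [/= [/= hx' hy'] hr]; apply: hd hr.
  by split=> /=; move: hx' hy'; rewrite /ball /= !ltr_norml.
- move=> e /= e0 he.
  exists (e / 2); first by rewrite divr_gt0.
  move=> [x y] [/= hx hy]; have := he (e / 2).
  move=> /(_ _ _ (x, y)) /=; apply; rewrite ?divr_gt0 //=.
    by rewrite sub0r normrN gtr0_norm ?divr_gt0// ltr_pdivrMr// mulr_natr mulr2n ltrDl.
Unshelve. all: by end_near.
Qed.
End Compactness.

(** * Cells and stars of a rhombic lattice *)

Section Local.
Variables (R : realType) (L : set (set R[i])).
Implicit Types (a b c d u v w x y z p q : R[i]) (A B : set R[i]) (s t r : R).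
Hypothesis latL : rhombic_lattice L.

Lemma lat_rh A : L A -> exists a u v, unit_rhombus_at a u v A.
Proof. by case: latL => h _ _ _; apply: h. Qed.

Lemma lat_cover p : exists2 A, L A & A p.
Proof.
case: latL => _ _ h _; have : [set: R[i]] p by [].
by rewrite -h => -[A LA Ap]; exists A.
Qed.

Definition midpoint p q : R[i] := ((Re p + Re q) / 2) +i* ((Im p + Im q) / 2).

Lemma rh_midpoint a u v A p q : unit_rhombus_at a u v A -> A p -> A q -> A (midpoint p q).
Proof.
move=> h /(rhP h)[s [t [hs ht ->]]] /(rhP h)[s' [t' [hs' ht' ->]]].
have -> : midpoint (pt a u v s t) (pt a u v s' t') = pt a u v ((s + s') / 2) ((t + t') / 2).
  by apply: eqcP; rewrite /midpoint /pt /= !reimE; field.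
by apply: (rh_pt h); lra.
Qed.

Lemma lat_midpoint A p q : L A -> A p -> A q -> A (midpoint p q).
Proof. by move=> /lat_rh[a [u [v h]]]; apply: rh_midpoint h. Qed.

Lemma side_sym A x y : side A x y -> side A y x.
Proof.
move=> [v h]; exists v; have := rh_flip h.
by rewrite opprB (_ : x + (y - x) = y) // addrC subrK.
Qed.

Lemma side_rh a u v A : unit_rhombus_at a u v A -> side A a (a + u).
Proof. by move=> h; exists v; rewrite (addrC a) addrK. Qed.

Lemma side_corner A x y : side A x y -> corner A x.
Proof. by move=> [v h]; exists (y - x), v. Qed.

Lemma seg_pt (x y : R[i]) t v : x + t%:C * (y - x) = pt x (y - x) v t 0.
Proof. by rewrite /pt mul0r addr0. Qed.

Lemma side_inner_corner A x y t : side A x y -> 0 < t < 1 ->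
  ~ corner A (x + t%:C * (y - x)).
Proof.
move=> [v h] ht; rewrite (seg_pt _ _ _ v) => /(corner_coord h)[[|] ? _]; lra.
Qed.

Lemma side_segment A x y t : side A x y -> 0 <= t <= 1 -> A (x + t%:C * (y - x)).
Proof. by move=> [v h] ht; rewrite (seg_pt _ _ _ v); apply: (rh_pt h) => //; lra. Qed.

(** The claim for all four sides of a representation, [P], is preserved by the moves of [rh_ind]; in
    the representation at [x] it is read off from the coordinates. *)
Lemma side_inner A x y x' y' t t' : side A x y -> side A x' y' ->
  0 < t < 1 -> 0 < t' < 1 ->
  x + t%:C * (y - x) = x' + t'%:C * (y' - x') ->
  (x' = x /\ y' = y) \/ (x' = y /\ y' = x).
Proof.
move=> [v h] [v' h'] ht ht'.
set u := y - x in h *; set u' := y' - x' in h' *.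
have -> : y = x + u by rewrite /u addrC subrK.
have -> : y' = x' + u' by rewrite /u' addrC subrK.
move: u u' h h' => u u' h h' {y y'}.
pose Q (x' u' : R[i]) t' := x + t%:C * u = x' + t'%:C * u' ->
   (x' = x /\ x' + u' = x + u) \/ (x' = x + u /\ x' + u' = x).
have Qflip b c r : Q b c (1 - r) -> Q (b + c) (- c) r.
  move=> H e; have /H : x + t%:C * u = b + (1 - r)%:C * c.
    by rewrite e; apply: eqcP; rewrite !reimE; ring.
  by rewrite addrK => -[[-> ->]|[-> ->]]; [right|left].
pose P (x' u' v' : R[i]) := forall t', 0 < t' < 1 ->
  [/\ Q x' u' t', Q x' v' t', Q (x' + u') v' t' & Q (x' + v') u' t'].
suff : P x' u' v' by move=> /(_ t' ht')[].
have D := rh_cross h.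
apply: (rh_ind _ _ h h').
- by move=> a b c hb H s hs; have [H1 H2 H3 H4] := H s hs.
- move=> a b c hb H s hs; have [H1 H2 H3 H4] := H s hs.
  have [|H1' _ _ H4'] := H (1 - s); first lra.
  split; [exact: Qflip|exact: H3|by rewrite addrK|].
  by rewrite addrAC; apply: Qflip.
- move=> s hs; split=> e.
  + by left.
  + have : pt x u v t 0 = pt x u v 0 s by rewrite /pt !mul0r !addr0.
    by move=> /(pt_inj D)[? ?]; exfalso; lra.
  + have : pt x u v t 0 = pt x u v 1 s by rewrite /pt !mul0r mul1r !addr0.
    by move=> /(pt_inj D)[? ?]; exfalso; lra.
  + have : pt x u v t 0 = pt x u v s 1.
      by rewrite /pt !mul0r mul1r !addr0 e addrAC.
    by move=> /(pt_inj D)[? ?]; exfalso; lra.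
Qed.

(** A point on two faces lies in their intersection, which by the edge-to-edge condition is a common
    corner or a common side. The cases are thus: vertex, inner point of an edge, point of a single
    face. *)
Lemma lat_cell p :
  [\/ forall A, L A -> A p -> corner A p,
      exists x y t, [/\ 0 < t < 1, p = x + t%:C * (y - x) &
        forall A, L A -> A p -> side A x y]
    | forall A B, L A -> L B -> A p -> B p -> A = B].
Proof.
have [[A [B [LA LB Ap Bp AB]]]|h] := pselect (exists A B, [/\ L A, L B, A p, B p & A <> B]);
  last first.
  constructor 3 => A B LA LB Ap Bp; apply: contrapT => AB.
  by apply: h; exists A, B.
have allcorner C : L C -> C p -> corner C p -> forall D, L D -> D p -> corner D p.
  move=> LC Cp cC D LD Dp.
  have [<-//|CD] := pselect (C = D).
  case: latL => _ _ _ /(_ _ _ LC LD CD)[e|[x [_ cx e]]|[x [y [s1 s2 e]]]].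
  - by have : (C `&` D) p by []; rewrite e.
  - by have : (C `&` D) p by []; rewrite e => ->.
  - have : (C `&` D) p by []; rewrite e => -[t ht pE].
    have [t0|t0] := eqVneq t 0.
      by rewrite pE t0 mul0r addr0; apply: side_corner s2.
    have [t1|t1] := eqVneq t 1.
      by rewrite pE t1 mul1r addrC subrK; apply: side_corner (side_sym s2).
    case: (side_inner_corner s1 (t := t)); last by rewrite -pE.
    by move/eqP: t0 => t0; move/eqP: t1 => t1; lra.
have [cA|ncA] := pselect (corner A p).
  by constructor 1; apply: (allcorner A).
have [cB|ncB] := pselect (corner B p).
  by constructor 1; apply: (allcorner B).
have onside C : L C -> C p -> C <> A -> exists x y t, [/\ 0 < t < 1, p = x + t%:C * (y - x),
    side A x y & side C x y].
  move=> LC Cp CA.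
  case: latL => _ _ _ /(_ _ _ LA LC (fun e => CA (esym e)))[e|[x [cx _ e]]|[x [y [s1 s2 e]]]].
  - by have : (A `&` C) p by []; rewrite e.
  - by have : (A `&` C) p by []; rewrite e => pE; case: ncA; rewrite pE.
  - have : (A `&` C) p by []; rewrite e => -[t ht pE].
    have [t0|/eqP t0] := eqVneq t 0.
      by case: ncA; rewrite pE t0 mul0r addr0; apply: side_corner s1.
    have [t1|/eqP t1] := eqVneq t 1.
      by case: ncA; rewrite pE t1 mul1r addrC subrK; apply: side_corner (side_sym s1).
    exists x, y, t; split=> //; lra.
have [x [y [t [ht pE sA sB]]]] := onside B LB Bp (fun e => AB (esym e)).
constructor 2; exists x, y, t; split=> // C LC Cp.
have [->//|CA] := pselect (C = A).
have [x' [y' [t' [ht' pE' sA' sC]]]] := onside C LC Cp CA.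
have [[-> ->]|[-> ->]] // := side_inner sA' sA ht' ht (etrans (esym pE') pE).
exact: side_sym.
Qed.

Lemma side_shared x y t A B : L A -> side A x y -> 0 < t < 1 -> L B ->
  B (x + t%:C * (y - x)) -> side B x y.
Proof.
move=> LA sA ht LB Bp.
have Ap : A (x + t%:C * (y - x)) by apply: side_segment sA _; lra.
case: (lat_cell (x + t%:C * (y - x))) => [h|[x' [y' [t' [ht' pE h]]]]|h].
- by case: (side_inner_corner sA ht); apply: h.
- have sA' := h A LA Ap; have sB := h B LB Bp.
  by case: (side_inner sA' sA ht' ht (esym pE)) => -[-> ->] //; apply: side_sym.
- by rewrite (h B A).
Qed.

(** This attaches a vertex to every point of the plane, so that arguments about vertices can follow
    arbitrary segments. *)
Lemma common_corner p : exists c, forall A, L A -> A p -> corner A c.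
Proof.
case: (lat_cell p) => [h|[x [y [t [ht pE h]]]]|h].
- by exists p.
- by exists x => A LA Ap; apply: side_corner (h A LA Ap).
- have [A LA Ap] := lat_cover p; have [a [u [v ha]]] := lat_rh LA.
  by exists a => B LB Bp; rewrite (h B A) //; exists u, v.
Qed.

Lemma center_uniq a u v A B : unit_rhombus_at a u v A -> L A -> L B ->
  B (pt a u v 2^-1 2^-1) -> A = B.
Proof.
move=> h LA LB Bp; set p := pt _ _ _ _ _ in Bp.
have Ap : A p by apply: (rh_pt h); lra.
case: (lat_cell p) => [hc|[x [y [t [ht pE hs]]]]|]; last by apply.
  exfalso; have := hc A LA Ap; move=> /(corner_coord h)[[|] ? _]; lra.
have [w h'] := hs A LA Ap.
(* If the center [p] were on a side, [A] would lie on one side of the line through it, so only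
   displacements parallel to that side could stay in [A] both ways. Both [u] and [v] provide such
   displacements at the center. *)
have crossw d1 : A (p + d1) -> A (p - d1) -> cross (y - x) d1 = 0.
  move=> /(rhP h')[s1 [t1 [hs1 ht1 e1]]] /(rhP h')[s2 [t2 [hs2 ht2 e2]]].
  have dE : d1 = (s1 - t)%:C * (y - x) + t1%:C * w.
    apply: (@addrI _ p); rewrite e1 pE /pt; apply: eqcP; rewrite !reimE; ring.
  have : pt x (y - x) w s2 t2 = pt x (y - x) w (t + t - s1) (- t1).
    rewrite -e2 dE pE /pt; apply: eqcP; rewrite !reimE; ring.
  move=> /(pt_inj (rh_cross h'))[_ t2E].
  have t10 : t1 = 0 by lra.
  by rewrite dE t10 /cross !reimE; ring.
have pD s t' : p + pt 0 u v s t' = pt a u v (2^-1 + s) (2^-1 + t').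
  by rewrite /p /pt; apply: eqcP; rewrite !reimE; ring.
have pB s t' : p - pt 0 u v s t' = pt a u v (2^-1 - s) (2^-1 - t').
  by rewrite /p /pt; apply: eqcP; rewrite !reimE; ring.
have cu := crossw (pt 0 u v 2^-1 0); rewrite pD pB in cu.
have cv := crossw (pt 0 u v 0 2^-1); rewrite pD pB in cv.
have {}cu : cross (y - x) (pt 0 u v 2^-1 0) = 0 by apply: cu; apply: (rh_pt h); lra.
have {}cv : cross (y - x) (pt 0 u v 0 2^-1) = 0 by apply: cv; apply: (rh_pt h); lra.
have D := rh_cross h; have n1 := (norm1P _).1 (rh_nu h').
move: cu cv D n1; rewrite /cross /pt !reimE /=.
move: (Re y - Re x) (Im y - Im x) => X Y cu cv D n1.
exfalso; move/eqP: D; apply.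
have cu' : X * Im u = Y * Re u by lra.
have cv' : X * Im v = Y * Re v by lra.
mulby n1 (Re u * Im v - Im u * Re v).
mulby cu' (X * Re v); mulby cv' (X * Re u).
mulby cu' (Y * Im v); mulby cv' (Y * Im u); lra.
Qed.
End Local.

(** * Uniform size of faces and Lebesgue numbers *)

Section Uniform.
Variables (R : realType) (L : set (set R[i])).
Implicit Types (a b c d u v w x y z p q : R[i]) (A B : set R[i]) (s t r : R).
Hypothesis latL : rhombic_lattice L.

Lemma norm_eq_sqr z w : `|z| = `|w| ->
  Re z ^+ 2 + Im z ^+ 2 = Re w ^+ 2 + Im w ^+ 2.
Proof.
case: w => x y; rewrite [in RHS]normc_def /= => /norm_sqr ->.
by rewrite sqr_sqrtr // addr_ge0 ?sqr_ge0.
Qed.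

(** The bound is the squared length of the longer diagonal. *)
Lemma rh_dist a u v A p q : unit_rhombus_at a u v A -> A p -> A q ->
  (Re p - Re q) ^+ 2 + (Im p - Im q) ^+ 2 <=
    2 + 2 * `|Re u * Re v + Im u * Im v|.
Proof.
move=> h /(rhP h)[s [t [hs ht ->]]] /(rhP h)[s' [t' [hs' ht' ->]]].
have /norm1P nu := rh_nu h; have /norm1P nv := rh_nv h.
rewrite /pt !reimE; set d := Re u * Re v + _.
rewrite [X in X <= _](_ : _ = (s - s') ^+ 2 + (t - t') ^+ 2 + 2 * ((s - s') * (t - t') * d)).
  have : (s - s') * (t - t') * d <= `|d|.
    apply: le_trans (ler_norm _) _; rewrite normrM ler_piMl // normrM.
    by rewrite mulr_ile1 // ler_norml; lra.
  have : (s - s') ^+ 2 <= 1 by nra.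
  have : (t - t') ^+ 2 <= 1 by nra.
  lra.
rewrite /d; mulby nu ((s - s') ^+ 2); mulby nv ((t - t') ^+ 2); lra.
Qed.

(** All faces are isometric to one face [A0], so their diagonals, of squared lengths 2 plus or minus
    twice the inner product of the sides, are bounded by the diameter of [A0]. This bounds the inner
    product away from 1 and -1, and the squared determinant is 1 minus its square. *)
Lemma cross_bound : exists2 k : R, 0 < k &
  forall A a u v, L A -> unit_rhombus_at a u v A -> k <= cross u v ^+ 2.
Proof.
have [A0 LA0 _] := lat_cover latL 0.
have [a0 [u0 [v0 h0]]] := lat_rh latL LA0.
exists (cross u0 v0 ^+ 2); first by rewrite exprn_even_gt0 //= (rh_cross h0).
move=> A a u v LA h.
have [phi iso AE] : congruent A0 A by case: latL => _ + _ _; apply.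
have dist x y : A x -> A y -> (Re x - Re y) ^+ 2 + (Im x - Im y) ^+ 2 <=
    2 + 2 * `|Re u0 * Re v0 + Im u0 * Im v0|.
  rewrite -AE => -[p Ap <-] [q Aq <-].
  have := norm_eq_sqr (iso p q); rewrite !reimE => ->.
  exact: rh_dist h0 Ap Aq.
have [c1 c2 c3 c4] := corner_rh h.
have d1 := dist _ _ (corner_in c1) (corner_in c4).
have d2 := dist _ _ (corner_in c2) (corner_in c3).
have /norm1P nu := rh_nu h; have /norm1P nv := rh_nv h.
have /norm1P nu0 := rh_nu h0; have /norm1P nv0 := rh_nv h0.
have sq x y : Re x ^+ 2 + Im x ^+ 2 = 1 -> Re y ^+ 2 + Im y ^+ 2 = 1 ->
  cross x y ^+ 2 = 1 - (Re x * Re y + Im x * Im y) ^+ 2.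
  by rewrite /cross => e1 e2; mulby e1 (Re y ^+ 2 + Im y ^+ 2); lra.
rewrite !sq // lerD2l lerN2 -[leRHS](real_normK (num_real _)).
rewrite -[leLHS](real_normK (num_real _)) lerXn2r ?nnegrE // ler_norml.
rewrite !reimE in d1 d2; apply/andP; split; lra.
Qed.

(** The coordinates of [z] by Cramer's rule, scaled by [cross u v ^+ 2]: no division, and the sign
    does not depend on the orientation. *)
Definition coord1 a u v z := cross (z - a) v * cross u v.
Definition coord2 a u v z := cross u (z - a) * cross u v.

Lemma rh_coordP a u v A z : unit_rhombus_at a u v A ->
  A z <-> 0 <= coord1 a u v z <= cross u v ^+ 2 /\ 0 <= coord2 a u v z <= cross u v ^+ 2.
Proof.
move=> h; have D := rh_cross h; have D2 : 0 < cross u v ^+ 2 by rewrite exprn_even_gt0.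
split=> [/(rhP h)[s [t [hs ht ->]]]|[hs ht]].
  have -> : coord1 a u v (pt a u v s t) = s * cross u v ^+ 2.
    by rewrite /coord1 /pt /cross !reimE; ring.
  have -> : coord2 a u v (pt a u v s t) = t * cross u v ^+ 2.
    by rewrite /coord2 /pt /cross !reimE; ring.
  by split; nra.
apply/(rhP h); exists (coord1 a u v z / cross u v ^+ 2), (coord2 a u v z / cross u v ^+ 2).
have f (x : R) : 0 <= x <= cross u v ^+ 2 -> 0 <= x / cross u v ^+ 2 <= 1.
  move=> hx; apply/andP; split; first by apply: divr_ge0; lra.
  by rewrite ler_pdivrMr // mul1r; lra.
split; [exact: f|exact: f|].
apply: eqcP; rewrite /pt !reimE /coord1 /coord2; move: D; rewrite /cross !reimE => D; field.
  by rewrite D.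
by rewrite D.
Qed.

Lemma cross_lipschitz (x y V1 V2 E r : R) : - r < x < r -> - r < y < r ->
  V1 ^+ 2 + V2 ^+ 2 = 1 -> E ^+ 2 <= 1 -> `|(x * V1 - y * V2) * E| <= 2 * r.
Proof.
move=> hx hy hV hE.
have a1 (a : R) : a ^+ 2 <= 1 -> `|a| <= 1.
  by move=> ha; rewrite -(@ler_pXn2r _ 2) ?nnegrE // expr1n real_normK ?num_real.
have V1l : `|V1| <= 1 by apply: a1; nra.
have V2l : `|V2| <= 1 by apply: a1; nra.
have xl : `|x| <= r by rewrite ler_norml; lra.
have yl : `|y| <= r by rewrite ler_norml; lra.
rewrite normrM; apply: (@le_trans _ _ `|x * V1 - y * V2|).
  by rewrite ler_piMr // a1.
apply: le_trans (ler_normB _ _) _; rewrite !normrM.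
have : `|x| * `|V1| <= r * 1 by apply: ler_pM.
have : `|y| * `|V2| <= r * 1 by apply: ler_pM.
lra.
Qed.

Lemma cross_sqr_le1 u v : `|u| = 1 -> `|v| = 1 -> cross u v ^+ 2 <= 1.
Proof.
move=> /norm1P nu /norm1P nv; rewrite /cross.
have := sqr_ge0 (Re u * Re v + Im u * Im v).
mulby nu (Re v ^+ 2 + Im v ^+ 2); lra.
Qed.

Lemma coord1_lipschitz a u v A p q r : unit_rhombus_at a u v A -> sup_close r p q ->
  `|coord1 a u v p - coord1 a u v q| <= 2 * r.
Proof.
move=> h [h1 h2]; have := cross_lipschitz h1 h2 _ (cross_sqr_le1 (rh_nu h) (rh_nv h)).
move=> /(_ (Im v) (Re v)); have /norm1P nv := rh_nv h.
rewrite (_ : coord1 a u v p - _ = ((Re p - Re q) * Im v - (Im p - Im q) * Re v) * cross u v).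
  by apply; lra.
by rewrite /coord1 /cross !reimE; ring.
Qed.

Lemma coord2_lipschitz a u v A p q r : unit_rhombus_at a u v A -> sup_close r p q ->
  `|coord2 a u v p - coord2 a u v q| <= 2 * r.
Proof.
move=> h; have h' := rh_swap h; move/(coord1_lipschitz h').
rewrite (_ : coord1 a v u p - coord1 a v u q = coord2 a u v p - coord2 a u v q) //.
by rewrite /coord1 /coord2 /cross !reimE; ring.
Qed.

Lemma rh_closed a u v A p : unit_rhombus_at a u v A -> ~ A p ->
  exists2 r, 0 < r & forall w, A w -> ~ sup_close r p w.
Proof.
move=> h nA.
pose S := coord1 a u v p; pose T := coord2 a u v p; pose D := cross u v ^+ 2.
have [r r0 hr] : exists2 r, 0 < r &
    [\/ S < - (2 * r), D + 2 * r < S, T < - (2 * r) | D + 2 * r < T].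
  have [h1|h1] := ltP S 0; first by exists (- S / 4); [lra|constructor 1; lra].
  have [h2|h2] := ltP D S; first by exists ((S - D) / 4); [lra|constructor 2; lra].
  have [h3|h3] := ltP T 0; first by exists (- T / 4); [lra|constructor 3; lra].
  have [h4|h4] := ltP D T; first by exists ((T - D) / 4); [lra|constructor 4; lra].
  by case: nA; apply/(rh_coordP _ h); split; apply/andP.
exists r => // w /(rh_coordP _ h)[hs ht] cl.
have := coord1_lipschitz h cl; have := coord2_lipschitz h cl; rewrite !ler_norml -/S -/T.
by rewrite -/D in hs ht; case: hr; lra.
Qed.

(* Faces contain a square of uniform size around their center, so nearby centers
   belong to the same face; compactness is applied to the set of centers. *)
Lemma local_star p : exists2 r, 0 < r & forall A w, L A -> A w -> sup_close r p w -> A p.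
Proof.
have [k k0 hk] := cross_bound.
have [A1 LA1 _] := lat_cover latL 0.
have k1 : k <= 1.
  have [a [u [v h]]] := lat_rh latL LA1.
  exact: le_trans (hk _ _ _ _ LA1 h) (cross_sqr_le1 (rh_nu h) (rh_nv h)).
pose ctr a u v := pt a u v 2^-1 2^-1.
have near_center a u v A z : L A -> unit_rhombus_at a u v A ->
    sup_close (k / 8) (ctr a u v) z -> A z.
  move=> LA h cl; have D := hk _ _ _ _ LA h.
  have := coord1_lipschitz h cl; have := coord2_lipschitz h cl; rewrite !ler_norml.
  have -> : coord1 a u v (ctr a u v) = 2^-1 * cross u v ^+ 2.
    by rewrite /coord1 /ctr /pt /cross !reimE; ring.
  have -> : coord2 a u v (ctr a u v) = 2^-1 * cross u v ^+ 2.
    by rewrite /coord2 /ctr /pt /cross !reimE; ring.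
  by move=> *; apply/(rh_coordP _ h); lra.
(* [P m r] says that a face centered at [m] which misses [p] stays [r]-far from [p]. *)
pose P m r := forall A a u v w, L A -> unit_rhombus_at a u v A -> m = ctr a u v ->
  ~ A p -> A w -> ~ sup_close r p w.
(* The box contains the center of every face that has a point within 1 of [p]: each coordinate of
   the center differs by at most 2 from that of the point. *)
have [|r r0 hr] := @box_uniform _ (Re p - 4) (Re p + 4) (Im p - 4) (Im p + 4) P.
  move=> m0 _.
  (* If a face [A0] missing [p] has its center near [m0], every face centered near [m0] is [A0],
     whose distance from [p] serves; otherwise no face missing [p] is centered near [m0]. *)
  have [[A0 [a0 [u0 [v0 [LA0 h0 nA0 cl0]]]]]|none] := pselect (exists A0 a0 u0 v0,
    [/\ L A0, unit_rhombus_at a0 u0 v0 A0, ~ A0 p & sup_close (k / 16) m0 (ctr a0 u0 v0)]).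
    have [r0 r0p hr0] := rh_closed h0 nA0.
    exists (Num.min (k / 16) r0); first by rewrite lt_min r0p andbT; lra.
    move=> m r cl hr A a u v w LA h mE nA Aw clw.
    have AE : A = A0.
      apply: (center_uniq latL h LA LA0); apply: near_center h0 _ => //.
      rewrite -/(ctr a u v) -mE.
      move: cl cl0; rewrite /sup_close; set d := Num.min _ _.
      have : d <= k / 16 by rewrite /d ge_min lexx.
      by move=> ? [? ?] [? ?]; split; lra.
    apply: (hr0 w); first by rewrite -AE.
    have : r < r0 by move/andP: hr => [_]; rewrite lt_min => /andP[].
    by move: clw => [? ?]; split; lra.
  exists (k / 16); first lra.
  move=> m r cl hr A a u v w LA h mE nA Aw clw; apply: none.
  by exists A, a, u, v; split=> //; rewrite -mE.
exists (Num.min r 1); first by rewrite lt_min r0 ltr01.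
move=> A w LA Aw clw; apply: contrapT => nA.
have [a [u [v h]]] := lat_rh latL LA.
have [c1 c2] : Num.min r 1 <= r /\ Num.min r 1 <= 1 by rewrite !ge_min !lexx orbT.
apply: (hr (ctr a u v) _ A a u v w) => //; last by case: clw => ? ?; split; lra.
move: Aw clw => /(rhP h)[s [t [hs ht ->]]].
have /norm1P nu := rh_nu h; have /norm1P nv := rh_nv h.
rewrite /box /sup_close /ctr /pt !reimE => -[].
have bd (x y : R) : x ^+ 2 + y ^+ 2 = 1 -> -1 <= x <= 1 /\ -1 <= y <= 1.
  by move=> e; split; nra.
have [u1 u2] := bd _ _ nu; have [v1 v2] := bd _ _ nv.
have bd2 (x y : R) : 0 <= x <= 1 -> -1 <= y <= 1 -> -1 <= (x - 2^-1) * y <= 1.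
  by move=> ? ?; nra.
have := bd2 _ _ hs u1; have := bd2 _ _ hs u2.
have := bd2 _ _ ht v1; have := bd2 _ _ ht v2.
by move=> ? ? ? ? ? ?; split; lra.
Qed.

(** With [common_corner], all faces that come [r]-close to [q] share a vertex. That [z] stays in the
    box matters when the box is a horizontal segment. *)
Lemma lebesgue_number (x0 x1 y0 y1 : R) : exists2 r, 0 < r &
  forall q, box x0 x1 y0 y1 q -> exists2 z, box x0 x1 y0 y1 z &
    forall A w, L A -> A w -> sup_close r q w -> A z.
Proof.
apply: (@box_uniform _ x0 x1 y0 y1 (fun q r => exists2 z, box x0 x1 y0 y1 z &
    forall A w, L A -> A w -> sup_close r q w -> A z)) => z hz.
have [r r0 hr] := local_star z.
exists (r / 2); first lra.
move=> q s [? ?] ?; exists z => // A w LA Aw [? ?]; apply: (hr A w) => //.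
by split; lra.
Qed.

End Uniform.

(** * Simple connectedness *)

Section Conn.
Variables (T : eqType) (e : T -> T -> Prop).

Definition epath (x : T) (p : seq T) : bool := path (fun x y => `[< e x y >]) x p.
Definition conn (x y : T) : Prop := exists2 p, epath x p & last x p = y.

Lemma conn_refl x : conn x x. Proof. by exists [::]. Qed.
Lemma conn_trans x y z : conn x y -> conn y z -> conn x z.
Proof.
move=> [p hp <-] [q hq <-]; exists (p ++ q); last by rewrite last_cat.
by rewrite /epath cat_path; apply/andP.
Qed.
Lemma conn_edge x y : e x y -> conn x y.
Proof. by move=> exy; exists [:: y] => //=; rewrite /epath /= andbT; apply/asboolP. Qed.
Lemma conn_sym : (forall x y, e x y -> e y x) -> forall x y, conn x y -> conn y x.
Proof.
move=> es x y [p + <-]; elim: p x => [|z p IH] x /=; first by move=> _; apply: conn_refl.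
move=> /andP[/asboolP xz /IH h]; apply: conn_trans h _; exact/conn_edge/es.
Qed.
End Conn.

Section SimplyConnected.
Variables (R : realType) (L : set (set R[i])).
Implicit Types (a b c d u v w x y z p q : R[i]) (A B : set R[i]) (s t r : R).
Hypothesis latL : rhombic_lattice L.

Lemma dyadic_bound (r M : R) : 0 < r -> exists n, M < r * 2 ^+ n.
Proof.
move=> r0; exists (Num.bound (M / r)).
rewrite mulrC -ltr_pdivrMr //; apply: le_lt_trans (ler_norm _) _.
apply: lt_le_trans (archi_boundP (normr_ge0 _)) _.
rewrite -natrX ler_nat (_ : Num.bound `|M / r| = Num.bound (M / r)).
  by apply/ltnW/ltn_expl.
by rewrite /Num.bound normr_id.
Qed.

Lemma midpointxx p : midpoint p p = p.
Proof. by apply: eqcP; rewrite /midpoint /=; field. Qed.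

Lemma box_midpoint (x0 x1 y0 y1 : R) p q : @box R x0 x1 y0 y1 p -> box x0 x1 y0 y1 q ->
  box x0 x1 y0 y1 (midpoint p q).
Proof. by rewrite /box /midpoint /= => -[? ?] [? ?]; split; lra. Qed.

Lemma sup_close_midpointl r p q : sup_close (r * 2) p q -> sup_close r p (midpoint p q).
Proof. by rewrite /sup_close /midpoint /= => -[? ?]; split; lra. Qed.
Lemma sup_close_midpointr r p q : sup_close (r * 2) p q -> sup_close r (midpoint p q) q.
Proof. by rewrite /sup_close /midpoint /= => -[? ?]; split; lra. Qed.
Lemma sup_close_refl r p : 0 < r -> sup_close r p p.
Proof. by rewrite /sup_close => ?; split; lra. Qed.
Lemma sup_close_sym r p q : sup_close r p q -> sup_close r q p.
Proof. by rewrite /sup_close => -[? ?]; split; lra. Qed.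
Lemma box_close (x0 x1 y0 y1 : R) : exists M : R, forall p q,
  box x0 x1 y0 y1 p -> box x0 x1 y0 y1 q -> forall r, M < r -> sup_close r p q.
Proof.
exists (`|x1 - x0| + `|y1 - y0|) => p q [? ?] [? ?] r.
have := ler_norm (x1 - x0); have := ler_norm (y1 - y0).
have := normr_ge0 (x1 - x0); have := normr_ge0 (y1 - y0).
by move=> *; split; lra.
Qed.

(** Composing through midpoints doubles the scale at which [E] is known, and the box is bounded. *)
Lemma midpoint_ind (x0 x1 y0 y1 r : R) (E : R[i] -> R[i] -> Prop) : 0 < r ->
  (forall p q, box x0 x1 y0 y1 p -> box x0 x1 y0 y1 q -> sup_close r p q -> E p q) ->
  (forall p q, box x0 x1 y0 y1 p -> box x0 x1 y0 y1 q ->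
     E p (midpoint p q) -> E (midpoint p q) q -> E p q) ->
  forall p q, box x0 x1 y0 y1 p -> box x0 x1 y0 y1 q -> E p q.
Proof.
move=> r0 loc step.
have H n p q : box x0 x1 y0 y1 p -> box x0 x1 y0 y1 q -> sup_close (r * 2 ^+ n) p q -> E p q.
  elim: n p q => [|n IH] p q Kp Kq; first by rewrite expr0 mulr1; apply: loc.
  rewrite exprSr mulrA => cl; have Km := box_midpoint Kp Kq.
  by apply: step => //; apply: IH => //; [apply: sup_close_midpointl|apply: sup_close_midpointr].
move=> p q Kp Kq; have [M hM] := box_close x0 x1 y0 y1.
have [n hn] := dyadic_bound M r0.
exact: H (hM _ _ Kp Kq _ hn).
Qed.

Lemma edge_sym a b : edge L a b -> edge L b a.
Proof. by move=> [A LA sA]; exists A => //; apply: side_sym. Qed.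

Lemma rh_edges a u v A : L A -> unit_rhombus_at a u v A ->
  [/\ edge L a (a + u), edge L a (a + v), edge L (a + u) (a + u + v) &
      edge L (a + v) (a + u + v)].
Proof.
move=> LA h; split; exists A => //.
- exact: side_rh h.
- exact: side_rh (rh_swap h).
- exact: side_rh (rh_swap (rh_flip h)).
- by rewrite addrAC; apply: side_rh (rh_swap (rh_flip (rh_swap h))).
Qed.

Lemma face_conn A x y : L A -> corner A x -> corner A y -> conn (edge L) x y.
Proof.
move=> LA [u [v h]] /(corner4 h) hy.
have [e1 e2 e3 e4] := rh_edges LA h.
case: hy => ->; [exact: conn_refl|exact: conn_edge|exact: conn_edge|].
by apply: conn_trans (conn_edge e1) (conn_edge e3).
Qed.

Lemma box_exists (s : seq R[i]) : exists M, forall x, x \in s -> box (- M) M (- M) M x.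
Proof.
elim: s => [|x s [M hM]]; first by exists 0.
exists (`|M| + `|Re x| + `|Im x|) => y; rewrite inE => /orP[/eqP ->|/hM[h1 h2]].
  have := ler_norm (Re x); have := ler_norm (Im x).
  have := ler_norm (- Re x); have := ler_norm (- Im x); rewrite !normrN.
  by have := normr_ge0 M; move=> *; split; lra.
have := ler_norm M; have := normr_ge0 (Re x); have := normr_ge0 (Im x).
by move=> *; split; lra.
Qed.

Lemma lattice_conn x y : vertices L x -> vertices L y -> conn (edge L) x y.
Proof.
move=> [A LA cA] [B LB cB].
have [M hM] := box_exists [:: x; y].
have [r r0 hr] := lebesgue_number latL (- M) M (- M) M.
(* Midpoints need not be vertices, so [E] speaks of corners of arbitrary faces through the two
   points. *)
pose E p q := forall A B x y, L A -> L B -> A p -> B q -> corner A x -> corner B y ->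
  conn (edge L) x y.
apply: (@midpoint_ind _ _ _ _ r E r0 _ _ x y _ _ A B) => //;
  try by [apply: corner_in|apply: hM; rewrite !inE eqxx ?orbT].
- move=> p q Kp Kq cl C D x' y' LC LD Cp Dq cC cD.
  have [z _ hz] := hr p Kp; have [c hc] := common_corner latL z.
  have hcC : corner C c by apply: hc => //; apply: (hz C p) => //; apply: sup_close_refl.
  have hcD : corner D c by apply: hc => //; apply: (hz D q).
  exact: conn_trans (face_conn LC cC hcC) (face_conn LD hcD cD).
- move=> p q Kp Kq E1 E2 C D x' y' LC LD Cp Dq cC cD.
  have [F LF Fm] := lat_cover latL (midpoint p q).
  have [a [u [v h]]] := lat_rh latL LF; have cF : corner F a by exists u, v.
  by apply: conn_trans (E1 C F x' a _ _ _ _ _ _) (E2 F D a y' _ _ _ _ _ _).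
Qed.

Lemma two_corners A B x y : L A -> L B -> corner A x -> corner A y ->
  corner B x -> corner B y -> [\/ A = B, x = y | side A x y /\ side B x y].
Proof.
move=> LA LB Ax Ay Bx By.
have [AB|AB] := pselect (A = B); first by constructor 1.
have Ix : (A `&` B) x by split; apply: corner_in.
have Iy : (A `&` B) y by split; apply: corner_in.
case: latL => _ _ _ /(_ _ _ LA LB AB)[e|[z [_ _ e]]|[z [w [s1 s2 e]]]].
- by move: Ix; rewrite e.
- by move: Ix Iy; rewrite e => -> ->; constructor 2.
- have ends p : corner A p -> segment z w p -> p = z \/ p = w.
    move=> cp [t ht pE].
    have [t0|/eqP t0] := eqVneq t 0; first by left; rewrite pE t0 mul0r addr0.
    have [t1|/eqP t1] := eqVneq t 1; first by right; rewrite pE t1 mul1r addrC subrK.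
    case: (side_inner_corner s1 (t := t)); last by rewrite -pE.
    lra.
  move: Ix Iy; rewrite e => /(ends _ Ax) hx /(ends _ Ay) hy.
  case: hx hy => -> [] ->; try by constructor 2.
    by constructor 3.
  by constructor 3; split; apply: side_sym.
Qed.

(** * Path independence of a transport that commutes around each rhombus *)

Section Transport.
Variables (X : Type) (T : R[i] -> R[i] -> X -> X).
Hypothesis T_inv : forall a b xi, edge L a b -> T b a (T a b xi) = xi.
Hypothesis T_rh : forall A a u v xi, L A -> unit_rhombus_at a u v A ->
  T (a + u) (a + u + v) (T a (a + u) xi) = T (a + v) (a + u + v) (T a (a + v) xi).

Fixpoint transport a (p : seq R[i]) (xi : X) : X :=
  if p is b :: q then transport b q (T a b xi) else xi.

Lemma transport_cat a (p q : seq R[i]) xi :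
  transport a (p ++ q) xi = transport (last a p) q (transport a p xi).
Proof. by elim: p a xi => //= b p IH a xi. Qed.

(** A trivialization of the transport over one face. The first two clauses range over all points, so
    that no corner conditions have to be carried along. *)
Definition face_section A (e : R[i] -> R[i] -> X -> X) : Prop :=
  [/\ forall x xi, e x x xi = xi,
      forall x y z xi, e y z (e x y xi) = e x z xi &
      forall x y xi, side A x y -> e x y xi = T x y xi].

Lemma face_section_ex A : L A -> exists e, face_section A e.
Proof.
move=> LA; have [a [u [v h]]] := lat_rh latL LA.
have [e1 e2 e3 e4] := rh_edges LA h.
have D := rh_cross h.
have n1 : a + u <> a.
  by rewrite -[X in _ <> X](pt00 a u v) -(pt10 a u v) => /(pt_inj D)[]; lra.
have n2 : a + v <> a.
  by rewrite -[X in _ <> X](pt00 a u v) -(pt01 a u v) => /(pt_inj D)[]; lra.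
have n3 : a + v <> a + u.
  by rewrite -[X in _ <> X](pt10 a u v) -(pt01 a u v) => /(pt_inj D)[]; lra.
have n4 : a + u + v <> a.
  by rewrite -[X in _ <> X](pt00 a u v) -(pt11 a u v) => /(pt_inj D)[]; lra.
have n5 : a + u + v <> a + u.
  by rewrite -[X in _ <> X](pt10 a u v) -(pt11 a u v) => /(pt_inj D)[]; lra.
have n6 : a + u + v <> a + v.
  by rewrite -[X in _ <> X](pt01 a u v) -(pt11 a u v) => /(pt_inj D)[]; lra.
(* [F x] carries a value from [a] to the corner [x], and [G x] back; going from [x] to [y] through
   [a] makes the composition law automatic. Any point other than the first three corners is treated
   as the fourth. *)
pose F x xi := if x == a then xi else if x == a + u then T a (a + u) xi else
  if x == a + v then T a (a + v) xi else T (a + u) (a + u + v) (T a (a + u) xi).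
pose G x xi := if x == a then xi else if x == a + u then T (a + u) a xi else
  if x == a + v then T (a + v) a xi else T (a + u) a (T (a + u + v) (a + u) xi).
have T_inv' x y xi : edge L x y -> T x y (T y x xi) = xi.
  by move=> /edge_sym; apply: T_inv.
have FK x xi : G x (F x xi) = xi.
  by rewrite /F /G; case: (x == a) => //; case: (x == a + u); last case: (x == a + v); rewrite !T_inv.
have GK x xi : F x (G x xi) = xi.
  by rewrite /F /G; case: (x == a) => //; case: (x == a + u); last case: (x == a + v); rewrite !T_inv'.
exists (fun x y xi => F y (G x xi)); split.
- by [].
- by move=> x y z xi; rewrite FK.
- pose Q x y := (forall xi, F y (G x xi) = T x y xi) /\ (forall xi, F x (G y xi) = T y x xi).
  have Qsym x y : Q x y -> Q y x by case.
  have Q1 x y : edge L x y -> (forall xi, F y xi = T x y (F x xi)) -> Q x y.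
    move=> exy H; split=> xi; first by rewrite H GK.
    by rewrite -{1}(T_inv' x y xi exy) -{1}(GK x (T y x xi)) -H FK.
  pose P b x y := [/\ Q b (b + x), Q b (b + y), Q (b + x) (b + x + y) & Q (b + y) (b + x + y)].
  move=> x y xi [w h'].
  suff [[+ _] _ _ _] : P x (y - x) w by rewrite (addrC x) subrK; apply.
  apply: (rh_ind _ _ h h').
  + by move=> b c d _ [? ? ? ?]; split; rewrite // addrAC.
  + move=> b c d _ [q1 q2 q3 q4]; split; rewrite ?addrK //; exact: Qsym.
  + have Fa zeta : F a zeta = zeta by rewrite /F eqxx.
    have Fu zeta : F (a + u) zeta = T a (a + u) zeta.
      by rewrite /F eqxx; move/eqP/negbTE: n1 => ->.
    have Fv zeta : F (a + v) zeta = T a (a + v) zeta.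
      by rewrite /F eqxx; move/eqP/negbTE: n2 => ->; move/eqP/negbTE: n3 => ->.
    have Fuv zeta : F (a + u + v) zeta = T (a + u) (a + u + v) (T a (a + u) zeta).
      rewrite /F; move/eqP/negbTE: n4 => ->; move/eqP/negbTE: n5 => ->.
      by move/eqP/negbTE: n6 => ->.
    split; apply: Q1 => // zeta; rewrite ?(Fa, Fu, Fv, Fuv) //.
    by rewrite (T_rh _ LA h).
Qed.

Section Holonomy.
Variable e : set R[i] -> R[i] -> R[i] -> X -> X.
Hypothesis he : forall A, L A -> face_section A (e A).

Lemma face_section_agree A B x y xi : L A -> L B -> corner A x -> corner A y ->
  corner B x -> corner B y -> e A x y xi = e B x y xi.
Proof.
move=> LA LB Ax Ay Bx By; have [A1 _ A3] := he LA; have [B1 _ B3] := he LB.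
case: (two_corners LA LB Ax Ay Bx By) => [-> //|->|[sA sB]].
- by rewrite A1 B1.
- by rewrite A3 // B3.
Qed.

Variables (x0 x1 y0 y1 : R).
Local Notation K := (box x0 x1 y0 y1).
Variable c : R[i] -> R[i].

(* [tau p q] compares values at the corners [c p] and [c q]. *)
Definition cocycle (r : R) (tau : R[i] -> R[i] -> X -> X) : Prop :=
  [/\ forall p xi, K p -> tau p p xi = xi,
      forall p q w xi, K p -> K q -> K w -> sup_close r p q -> sup_close r q w -> sup_close r p w ->
        tau q w (tau p q xi) = tau p w xi &
      forall A p q xi, L A -> K p -> K q -> A p -> A q -> sup_close r p q ->
        tau p q xi = e A (c p) (c q) xi].

(** The midpoints of a triangle with sides below [r * 2] are within [r] of each other, so the new
    cocycle identity splits into identities for the four small triangles. *)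
Lemma cocycle_double r tau : 0 < r -> cocycle r tau -> exists tau', cocycle (r * 2) tau'.
Proof.
move=> r0 [t1 t2 t3].
exists (fun p q xi => tau (midpoint p q) q (tau p (midpoint p q) xi)); split.
- by move=> p xi Kp; rewrite midpointxx !t1.
- move=> p q w xi Kp Kq Kw c1 c2 c3.
  have Kpq := box_midpoint Kp Kq; have Kqw := box_midpoint Kq Kw.
  have Kpw := box_midpoint Kp Kw.
  have d1 := sup_close_midpointl c1; have d2 := sup_close_midpointr c1.
  have d3 := sup_close_midpointl c2; have d4 := sup_close_midpointr c2.
  have d5 := sup_close_midpointl c3; have d6 := sup_close_midpointr c3.
  have f1 : sup_close r (midpoint p q) (midpoint q w).
    by move: c3; rewrite /sup_close /midpoint /= => -[? ?]; split; lra.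
  have f2 : sup_close r (midpoint p q) (midpoint p w).
    by move: c2; rewrite /sup_close /midpoint /= => -[? ?]; split; lra.
  have f3 : sup_close r (midpoint p w) (midpoint q w).
    by move: c1; rewrite /sup_close /midpoint /= => -[? ?]; split; lra.
  rewrite (t2 (midpoint p q) q (midpoint q w)) //.
  rewrite -(t2 (midpoint p w) (midpoint q w) w) // -(t2 p (midpoint p q) (midpoint p w)) //.
  by rewrite (t2 (midpoint p q) (midpoint p w) (midpoint q w)).
- move=> A p q xi LA Kp Kq Ap Aq cl.
  have Am := lat_midpoint latL LA Ap Aq; have Km := box_midpoint Kp Kq.
  have d1 := sup_close_midpointl cl; have d2 := sup_close_midpointr cl.
  have [_ e2 _] := he LA.
  by rewrite (t3 A) // (t3 A p) // e2.
Qed.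

Lemma cocycle_global r tau : 0 < r -> cocycle r tau ->
  exists s tau', cocycle s tau' /\ forall p q, K p -> K q -> sup_close s p q.
Proof.
move=> r0 h0; have [M hM] := box_close x0 x1 y0 y1.
have [n hn] := dyadic_bound M r0.
have [tau' htau'] : exists tau', cocycle (r * 2 ^+ n) tau'.
  elim: n {hn} => [|n [t ht]]; first by exists tau; rewrite expr0 mulr1.
  rewrite exprSr mulrA; apply: cocycle_double ht.
  by rewrite mulr_gt0 // exprn_gt0.
by exists (r * 2 ^+ n), tau'; split=> // p q Kp Kq; apply: hM.
Qed.

Hypothesis c_star : exists2 r, 0 < r &
  forall p A w, K p -> L A -> A w -> sup_close r p w -> corner A (c p).

Lemma c_corner p A : K p -> L A -> A p -> corner A (c p).
Proof. by case: c_star => r r0 h Kp LA Ap; apply: (h p A p) => //; apply: sup_close_refl. Qed.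

(** For [q] near [p] both [c p] and [c q] are corners of every face through [p], so the section of
    any such face can be used and [face_section_agree] makes the choice irrelevant. *)
Lemma cocycle_ex : exists r tau, 0 < r /\ cocycle r tau.
Proof.
have /choice[f hf] : forall p, exists A, L A /\ A p.
  move=> p; by have [A LA Ap] := lat_cover latL p; exists A.
case: c_star => r r0 hr; exists r, (fun p q => e (f p) (c p) (c q)); split=> //.
have agree A p q xi : L A -> K p -> K q -> A p -> sup_close r p q ->
    e (f p) (c p) (c q) xi = e A (c p) (c q) xi.
  move=> LA Kp Kq Ap cl; have [Lf fp] := hf p.
  have cl' := sup_close_sym cl; have clp := sup_close_refl p r0.
  by apply: face_section_agree => //;
    by [apply: (hr p _ p)|apply: (hr q _ p)].
split.
- by move=> p xi Kp; have [Lf fp] := hf p; have [-> _ _] := he Lf.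
- move=> p q w xi Kp Kq Kw c1 c2 c3.
  have [Lp fp] := hf p; have [Lq fq] := hf q; have [_ e2 _] := he Lq.
  have cp := c_corner Kp Lp fp.
  have -> : e (f p) (c p) (c q) xi = e (f q) (c p) (c q) xi.
    by apply: face_section_agree => //;
     by [apply: (hr p _ q)|apply: (hr q _ p) => //; apply: sup_close_sym|apply: (hr q _ q) => //; apply: sup_close_refl].
  have -> : e (f p) (c p) (c w) xi = e (f q) (c p) (c w) xi.
    by apply: face_section_agree => //;
     by [apply: (hr p _ q)|apply: (hr w _ p) => //; apply: sup_close_sym|apply: (hr w _ q) => //; apply: sup_close_sym].
  by rewrite e2.
- by move=> A p q xi LA Kp Kq Ap Aq cl; apply: agree.
Qed.

Lemma box_path_indep a (p q : seq R[i]) xi : vertices L a -> K a -> {in p, forall z, K z} ->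
  {in q, forall z, K z} -> epath (edge L) a p -> epath (edge L) a q ->
  last a p = last a q -> transport a p xi = transport a q xi.
Proof.
have [r [tau0 [r0 h0]]] := cocycle_ex.
have [s [tau [[t1 t2 t3] cl]]] := cocycle_global r0 h0.
(* [kappa A z] carries a value from the vertex [z] to its chosen corner [c z]. Seen through [kappa],
   transport along an edge is [tau], so transport along a path is [tau] between its ends. *)
pose kappa A z := e A z (c z).
have key z w A zeta : L A -> side A z w -> K z -> K w ->
    forall B, L B -> corner B w -> kappa B w (T z w zeta) = tau z w (kappa A z zeta).
  move=> LA sA Kz Kw B LB cB.
  have cz := side_corner sA; have cw := side_corner (side_sym sA).
  have Az := corner_in cz; have Aw := corner_in cw.
  have [_ e2 e3] := he LA.
  rewrite /kappa (@face_section_agree B A) //; try by apply: c_corner => //; apply: corner_in.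
  by rewrite -e3 // e2 (t3 A) ?e2 //; apply: cl.
have kappa_indep A B z zeta : L A -> L B -> corner A z -> corner B z -> K z ->
    kappa A z zeta = kappa B z zeta.
  by move=> LA LB cA cB Kz; apply: face_section_agree => //; apply: c_corner => //;
    apply: corner_in.
have main : forall (p : seq R[i]) a A zeta, L A -> corner A a -> K a -> {in p, forall z, K z} ->
    epath (edge L) a p -> forall B, L B -> corner B (last a p) ->
    kappa B (last a p) (transport a p zeta) = tau a (last a p) (kappa A a zeta).
  elim=> [|z p' IH] b A zeta LA cA Kb Kp; first by move=> _ B LB cB /=; rewrite t1 //; apply: kappa_indep.
  rewrite /epath /= => /andP[/asboolP[A' LA' sA'] hp'] B LB cB.
  have Kz : K z by apply: Kp; rewrite inE eqxx.
  have Kp' : {in p', forall w, K w} by move=> w hw; apply: Kp; rewrite inE hw orbT.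
  have cz := side_corner (side_sym sA').
  rewrite (IH z A') //.
  have Kl : K (last z p').
    by have := mem_last z p'; rewrite inE => /orP[/eqP ->|/Kp'].
  rewrite (key b z A') // t2 //; try exact: cl.
  by congr tau; apply: kappa_indep => //; apply: side_corner sA'.
move=> [A LA cA] Ka Kp Kq hp hq E.
have [B LB cB] : vertices L (last a p).
  elim: p a A LA cA hp {Ka Kp Kq hq E} => [|z p IH] a A LA cA /=; first by exists A.
  rewrite /epath /= => /andP[/asboolP[A' LA' sA'] hp'].
  by apply: (IH z A') => //; apply: side_corner (side_sym sA').
have m1 := main p a A xi LA cA Ka Kp hp B LB cB.
rewrite E in cB m1.
have m2 := main q a A xi LA cA Ka Kq hq B LB cB.
have [e1 e2 _] := he LB.
rewrite -[LHS](e1 (last a q)) -[RHS](e1 (last a q)).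
by rewrite -!(e2 (last a q) (c (last a q)) (last a q)) -/(kappa B _ _) m1 -m2.
Qed.
End Holonomy.

Lemma path_indep a (p q : seq R[i]) xi : vertices L a -> epath (edge L) a p ->
  epath (edge L) a q -> last a p = last a q -> transport a p xi = transport a q xi.
Proof.
move=> va hp hq E.
have [M hM] := box_exists (a :: p ++ q).
have /choice[e he] : forall A, exists e, L A -> face_section A e.
  move=> A.
  have [LA|nLA] := pselect (L A); last by exists (fun _ _ xi => xi).
  by have [e he] := face_section_ex LA; exists e.
have [r r0 hr] := lebesgue_number latL (- M) M (- M) M.
(* In the box around both paths, [c] chooses a vertex common to all faces near a point; outside, the
   value 0 is arbitrary. *)
have /choice[c hc] : forall p, exists c, box (- M) M (- M) M p ->
    forall A w, L A -> A w -> sup_close r p w -> corner A c.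
  move=> z.
  have [Kz|nKz] := pselect (box (- M) M (- M) M z); last by exists 0.
  have [z' _ hz] := hr z Kz; have [c hc] := common_corner latL z'.
  by exists c => _ A w LA Aw cl; apply: hc => //; apply: hz Aw cl.
apply: (box_path_indep he (x0 := - M) (x1 := M) (y0 := - M) (y1 := M) (c := c)) => //.
- by exists r => // z A w Kz LA Aw cl; apply: (hc z Kz A w).
- by apply: hM; rewrite inE eqxx.
- by move=> z hz; apply: hM; rewrite inE mem_cat hz orbT.
- by move=> z hz; apply: hM; rewrite inE mem_cat hz !orbT.
Qed.

(** The section is transport along arbitrarily chosen paths from [x0]. It yields the levels ([X] is
    [int]) and the primitives ([X] is [V]). *)
Lemma global_section x0 xi : vertices L x0 -> exists s : R[i] -> X,
  s x0 = xi /\ forall x y, edge L x y -> s y = T x y (s x).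
Proof.
move=> v0.
have /choice[f hf] : forall x, exists f, vertices L x ->
    epath (edge L) x0 f /\ last x0 f = x.
  move=> x.
  have [vx|nvx] := pselect (vertices L x); last by exists [::].
  by have [p hp1 hp2] := lattice_conn v0 vx; exists p.
exists (fun x => transport x0 (f x) xi); split.
  have [h1 h2] := hf x0 v0.
  by rewrite (@path_indep x0 (f x0) [::]).
move=> x y exy.
have [A LA sA] := exy.
have [h1 h2] : epath (edge L) x0 (f x) /\ last x0 (f x) = x.
  by apply: hf; exists A => //; apply: side_corner sA.
have [h3 h4] : epath (edge L) x0 (f y) /\ last x0 (f y) = y.
  by apply: hf; exists A => //; apply: side_corner (side_sym sA).
rewrite (@path_indep x0 (f y) (f x ++ [:: y])) //.
- by rewrite transport_cat h2.
- by rewrite /epath cat_path h2 /=; apply/and3P; split=> //; apply/asboolP.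
- by rewrite last_cat.
Qed.
End Transport.
End SimplyConnected.

(** * Levels *)

Lemma int_between (R : realType) (m n : int) :
  n%:~R - 1 < (m%:~R : R) < n%:~R + 1 -> m = n.
Proof.
have -> : (n%:~R : R) - 1 = (n - 1)%:~R by rewrite rmorphB.
have -> : (n%:~R : R) + 1 = (n + 1)%:~R by rewrite rmorphD.
move=> /andP[]; rewrite !ltr_int.
lia.
Qed.

Lemma int_ind2 (P : int -> Prop) : P 0 -> (forall n, P n -> P (n + 1)) ->
  (forall n, P (n + 1) -> P n) -> forall n, P n.
Proof.
move=> P0 up dn; case=> n.
  by elim: n => // n /up; rewrite (_ : n%:Z + 1 = n.+1) //; lia.
elim: n => [|n IH]; first by apply: dn; rewrite (_ : Negz 0 + 1 = 0).
by apply: dn; rewrite (_ : Negz n.+1 + 1 = Negz n) //; lia.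
Qed.

Section Levels.
Variables (R : realType) (L : set (set R[i])).
Implicit Types (a b c d e u v w x y z p q : R[i]) (A B : set R[i]) (s t r : R).
Hypothesis latL : rhombic_lattice L.

Definition jump e : int := (e == 1)%:Z - (e == -1)%:Z.

Lemma one_neqN1 : (1 : R[i]) != -1.
Proof. by rewrite -subr_eq0 opprK (_ : 1 + 1 = 2%:R) // pnatr_eq0. Qed.

Lemma jump1 : jump 1 = 1.
Proof. by rewrite /jump eqxx (negbTE one_neqN1). Qed.

Lemma jumpN e : jump (- e) = - jump e.
Proof. by rewrite /jump eqr_oppLR eqr_opp opprB. Qed.

Lemma jump0 e : e != 1 -> e != -1 -> jump e = 0.
Proof. by rewrite /jump => /negbTE -> /negbTE ->. Qed.

(** Opposite sides of a rhombus have equal jumps, so adding jumps commutes around each face. *)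
Lemma level_ex : exists h : R[i] -> int, forall x y, edge L x y -> h y = h x + jump (y - x).
Proof.
have [A LA _] := lat_cover latL 0; have [a [u [v h]]] := lat_rh latL LA.
have va : vertices L a by exists A => //; exists u, v.
have [|B b x y n LB hB|f [_ hf]] := @global_section _ L latL int (fun a b n => n + jump (b - a)) _ _ a 0 va.
- by move=> x y n _; rewrite -(opprB y x) jumpN addrK.
- have addlK (c d : R[i]) : c + d - c = d by rewrite addrAC subrr add0r.
  by rewrite !addlK (addrAC b) addlK addrAC.
- by exists f.
Qed.

Definition left_end a : Prop := edge L a (a + 1).

Definition nonunit_edge x y : Prop := [/\ edge L x y, y - x != 1 & y - x != -1].
Definition nconn := conn nonunit_edge.

Lemma nonunit_sym x y : nonunit_edge x y -> nonunit_edge y x.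
Proof.
move=> [e1 e2 e3]; split; first exact: edge_sym.
  by rewrite -(opprB y x) eqr_oppLR.
by rewrite -(opprB y x) eqr_opp.
Qed.

Lemma nconn_sym x y : nconn x y -> nconn y x.
Proof. exact/conn_sym/nonunit_sym. Qed.

Lemma rh1_v a v A : unit_rhombus_at a 1 v A -> v != 1 /\ v != -1.
Proof. by case. Qed.

Lemma rh1_Im a v A : unit_rhombus_at a 1 v A -> Im v != 0.
Proof. by move=> /rh_cross; rewrite /cross /= mul1r mul0r subr0. Qed.

Definition nonunit_face A := forall a u v, unit_rhombus_at a u v A ->
  [/\ u != 1, u != -1, v != 1 & v != -1].

Lemma face_kind A : L A -> (exists a v, unit_rhombus_at a 1 v A) \/ nonunit_face A.
Proof.
move=> LA; have [a [u [v h]]] := lat_rh latL LA.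
have [u1|u1] := eqVneq u 1; first by left; exists a, v; rewrite -u1.
have [u2|u2] := eqVneq u (-1).
  by left; exists (a + u), v; have := rh_flip h; rewrite u2 opprK.
have [v1|v1] := eqVneq v 1; first by left; exists a, u; rewrite -v1; apply: rh_swap.
have [v2|v2] := eqVneq v (-1).
  by left; exists (a + v), u; have := rh_flip (rh_swap h); rewrite v2 opprK.
right => a' u' v' h'.
apply: (@rh_ind R (fun _ u v => [/\ u != 1, u != -1, v != 1 & v != -1]) A _ _ a u v a' u' v' h h').
- by move=> ? ? ? _ [].
- by move=> ? x ? _ [? ? ? ?]; split; rewrite // eqr_oppLR ?opprK.
- by [].
Qed.

Section Level.
Variable h : R[i] -> int.
Hypothesis hE : forall x y, edge L x y -> h y = h x + jump (y - x).
Local Notation hR x := ((h x)%:~R : R).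
Local Notation dR e := ((jump e)%:~R : R).

Lemma h_edge a u : edge L a (a + u) -> h (a + u) = h a + jump u.
Proof. by move/hE; rewrite (addrC a u) addrK. Qed.

Lemma h_nonunit x y : nonunit_edge x y -> h y = h x.
Proof. by move=> [/hE -> h1 h2]; rewrite jump0 // addr0. Qed.

Lemma h_left a : left_end a -> h (a + 1) = h a + 1.
Proof. by move/h_edge; rewrite jump1. Qed.

Definition interp_at a u v s t : R := hR a + s * dR u + t * dR v.
(* The interpolation of [h] to the plane, affine on each face; it is stated as a
   relation because [p] may lie on several faces. *)
Definition interp p (eta : R) : Prop := exists A a u v s t,
  [/\ L A, unit_rhombus_at a u v A, 0 <= s <= 1 /\ 0 <= t <= 1,
      p = pt a u v s t & eta = interp_at a u v s t].

Lemma interp_same_face A a u v s t a' u' v' s' t' : L A ->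
  unit_rhombus_at a u v A -> unit_rhombus_at a' u' v' A ->
  pt a u v s t = pt a' u' v' s' t' -> interp_at a u v s t = interp_at a' u' v' s' t'.
Proof.
move=> LA h1 h2.
pose P a' u' v' := forall s' t', pt a u v s t = pt a' u' v' s' t' ->
  interp_at a u v s t = interp_at a' u' v' s' t'.
suff : P a' u' v' by apply.
apply: (rh_ind _ _ h1 h2).
- move=> b x y _ H s1 t1 e; rewrite (H t1 s1); first by rewrite /interp_at addrAC.
  by rewrite e /pt addrAC.
- move=> b x y hb H s1 t1 e; rewrite (H (1 - s1) t1).
    have [e1 _ _ _] := rh_edges LA hb.
    by rewrite /interp_at (h_edge e1) jumpN intrD mulrNz; ring.
  by rewrite e /pt; apply: eqcP; rewrite !reimE; ring.
- by move=> s1 t1 /(pt_inj (rh_cross h1))[-> ->].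
Qed.

Lemma interp_ex p : exists eta, interp p eta.
Proof.
have [A LA Ap] := lat_cover latL p; have [a [u [v hA]]] := lat_rh latL LA.
have [s [t [hs ht pE]]] := (rhP hA p).1 Ap.
by exists (interp_at a u v s t), A, a, u, v, s, t.
Qed.

Lemma interp_pt A a u v s t : L A -> unit_rhombus_at a u v A -> 0 <= s <= 1 -> 0 <= t <= 1 ->
  interp (pt a u v s t) (interp_at a u v s t).
Proof. by move=> LA hA hs ht; exists A, a, u, v, s, t. Qed.

(** By [lat_cell], both representations can be rebased at a shared vertex or along a shared side,
    where the value depends only on the shared data, unless the two faces coincide. *)
Lemma interp_uniq p eta eta' : interp p eta -> interp p eta' -> eta = eta'.
Proof.
move=> [A [a [u [v [s [t [LA hA [hs ht] pE ->]]]]]]].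
move=> [B [b [x [y [s' [t' [LB hB [hs' ht'] pE' ->]]]]]]].
have Ap : A p by rewrite pE; apply: (rh_pt hA).
have Bp : B p by rewrite pE'; apply: (rh_pt hB).
case: (lat_cell latL p) => [cor|[z [w [tau [htau pz sd]]]]|uniq].
- have [u1 [v1 h1]] := cor A LA Ap; have [u2 [v2 h2]] := cor B LB Bp.
  rewrite (@interp_same_face A a u v s t p u1 v1 0 0) -?pE ?pt00 //.
  rewrite (@interp_same_face B b x y s' t' p u2 v2 0 0) -?pE' ?pt00 //.
  by rewrite /interp_at !mul0r.
- have [v1 h1] := sd A LA Ap; have [v2 h2] := sd B LB Bp.
  rewrite (@interp_same_face A a u v s t z (w - z) v1 tau 0) -?pE ?pz -?seg_pt //.
  rewrite (@interp_same_face B b x y s' t' z (w - z) v2 tau 0) -?pE' ?pz -?seg_pt //.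
  by rewrite /interp_at !mul0r.
- have AB := uniq A B LA LB Ap Bp; rewrite -AB in hB.
  by apply: (interp_same_face LA hA hB); rewrite -pE -pE'.
Qed.

Lemma interp_vertex x : vertices L x -> interp x (hR x).
Proof.
move=> [A LA [u [v hA]]]; exists A, x, u, v, 0, 0; rewrite /interp_at pt00 !mul0r !addr0.
by split=> //; lra.
Qed.

Lemma interp_unit_face A a v s t : L A -> unit_rhombus_at a 1 v A -> 0 <= s <= 1 -> 0 <= t <= 1 ->
  interp (pt a 1 v s t) (hR a + s).
Proof.
move=> LA hA hs ht; have := interp_pt LA hA hs ht; rewrite /interp_at jump1.
by have [v1 v2] := rh1_v hA; rewrite jump0 // mulr0 addr0 mulr1.
Qed.

Lemma interp_nonunit_face A a u v p eta : L A -> nonunit_face A -> unit_rhombus_at a u v A ->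
  A p -> interp p eta -> eta = hR a.
Proof.
move=> LA nA hA /(rhP hA)[s [t [hs ht pE]]] hp.
have := interp_pt LA hA hs ht; rewrite -pE => /(interp_uniq hp) ->.
by have [? ? ? ?] := nA _ _ _ hA; rewrite /interp_at !jump0 // !mulr0 !addr0.
Qed.

Lemma rh_between A p q z : L A -> A p -> A q -> Im p = Im z -> Im q = Im z ->
  Re p <= Re z <= Re q -> A z.
Proof.
move=> LA Ap Aq e1 e2 hz; have [a [u [v hA]]] := lat_rh latL LA.
move: Ap Aq => /(rh_coordP _ hA)[hp1 hp2] /(rh_coordP _ hA)[hq1 hq2].
apply/(rh_coordP _ hA).
have lin (k c0 x1 x2 x3 D : R) : x1 <= x2 <= x3 -> 0 <= k * x1 + c0 <= D ->
    0 <= k * x3 + c0 <= D -> 0 <= k * x2 + c0 <= D.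
  by move=> ? ? ?; have [k0|k0] := ltP k 0; nra.
have E1 w : Im w = Im z -> coord1 a u v w = (Im v * cross u v) * Re w +
    (- Re a * Im v - (Im z - Im a) * Re v) * cross u v.
  by move=> ew; rewrite /coord1 /cross !reimE ew; ring.
have E2 w : Im w = Im z -> coord2 a u v w = (- Im u * cross u v) * Re w +
    (Im u * Re a + (Im z - Im a) * Re u) * cross u v.
  by move=> ew; rewrite /coord2 /cross !reimE ew; ring.
by move: hp1 hp2 hq1 hq2; rewrite !E1 // !E2 // => *; split; apply: lin hz _ _.
Qed.

(** On a face with horizontal sides the height fixes [t], and both [Re] and the interpolation grow
    with [s]; on any other face the interpolation is constant. *)
Lemma interp_mono_face A p q eta eta' : L A -> A p -> A q -> Im p = Im q -> Re p <= Re q ->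
  interp p eta -> interp q eta' -> eta <= eta'.
Proof.
move=> LA Ap Aq e le hp hq.
case: (face_kind LA) => [[a [v hA]]|nA].
  move: Ap Aq => /(rhP hA)[s [t [hs ht pE]]] /(rhP hA)[s' [t' [hs' ht' qE]]].
  have := interp_unit_face LA hA hs ht; rewrite -pE => /(interp_uniq hp) ->.
  have := interp_unit_face LA hA hs' ht'; rewrite -qE => /(interp_uniq hq) ->.
  have V := rh1_Im hA.
  move: e le; rewrite pE qE /pt !reimE /= => e le.
  have /eqP : (t - t') * Im v = 0 by lra.
  rewrite mulf_eq0 (negbTE V) orbF => /eqP tt.
  have {}tt : t' = t by lra.
  by rewrite tt in le; lra.
have [a [u [v hA]]] := lat_rh latL LA.
by rewrite (interp_nonunit_face LA nA hA Ap hp) (interp_nonunit_face LA nA hA Aq hq).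
Qed.

Lemma interp_mono p q eta eta' : Im p = Im q -> Re p <= Re q ->
  interp p eta -> interp q eta' -> eta <= eta'.
Proof.
move=> e le.
have [r r0 hr] := lebesgue_number latL (Re p) (Re q) (Im p) (Im p).
pose E p q := Im p = Im q -> Re p <= Re q -> forall eta eta',
  interp p eta -> interp q eta' -> eta <= eta'.
suff : E p q by move=> H; apply: H.
apply: (@midpoint_ind _ (Re p) (Re q) (Im p) (Im p) r E r0).
- move=> x y Kx Ky cl exy lexy et et' hx hy.
  have [z Kz hz] := hr x Kx.
  have [A LA Ax] := lat_cover latL x; have [B LB By] := lat_cover latL y.
  have Az : A z by apply: (hz A x) => //; apply: sup_close_refl.
  have Bz : B z by apply: (hz B y).
  have [zeta hzeta] := interp_ex z.
  have ez : Im z = Im x by move: Kx Kz => [_ ?] [_ ?]; lra.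
  (* The faces [A] at [x] and [B] at [y] share [z], which lies on the same horizontal line. If [z]
     is outside the segment, one face contains both [x] and [y] by convexity; otherwise the estimate
     passes through [z]. *)
  have [zx|zx] := leP (Re z) (Re x).
    have Bx : B x by apply: (@rh_between B z y) => //; lra.
    exact: (interp_mono_face LB Bx By).
  have [zy|zy] := leP (Re z) (Re y).
    by apply: le_trans (interp_mono_face LA Ax Az _ _ hx hzeta) (interp_mono_face LB Bz By _ _ hzeta hy); lra.
  have Ay : A y by apply: (@rh_between A x z) => //; lra.
  exact: (interp_mono_face LA Ax Ay).
- move=> x y Kx Ky E1 E2 exy lexy et et' hx hy.
  have [zeta hz] := interp_ex (midpoint x y).
  apply: le_trans (E1 _ _ _ _ hx hz) (E2 _ _ _ _ hz hy); rewrite /midpoint /=; lra.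
- by split; lra.
- by split; lra.
Qed.

End Level.
End Levels.

(** * Tracks *)

Section Tracks.
Variables (R : realType) (L : set (set R[i])).
Implicit Types (a b c d e u v w x y z p q : R[i]) (A B : set R[i]) (s t r : R).
Hypothesis latL : rhombic_lattice L.
Local Notation left_end := (left_end L).
Local Notation nconn := (nconn L).

(** A small vertical displacement of the midpoint of the edge, upward or downward according to [sg],
    lands in a face that still contains the midpoint and therefore has the edge as a side. *)
Lemma unit_face (sg : R) a : sg ^+ 2 = 1 -> left_end a ->
  exists A v, [/\ L A, unit_rhombus_at a 1 v A & 0 < sg * Im v].
Proof.
move=> sg2 [A LA sA].
pose m := a + (2^-1 : R)%:C * (a + 1 - a).
have a1 : a + 1 - a = 1 by rewrite addrAC subrr add0r.
have [r r0 hr] := local_star latL m.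
pose m' := m + (0 +i* (sg * (r / 2))).
have [B LB Bm'] := lat_cover latL m'.
have Bm : B m.
  apply: (hr B m') => //; rewrite /sup_close /m' !reimE /=.
  have : -1 <= sg <= 1 by nra.
  by move=> ?; split; nra.
have [|v hB] := side_shared latL LA sA _ LB Bm; first lra.
rewrite a1 in hB; exists B, v; split=> //.
move: Bm' => /(rhP hB)[s [t [hs ht e]]].
have := congr1 (@complex.Im R) e.
rewrite /m' /m a1 /pt !reimE /= => eI.
have E : t * (sg * Im v) = r / 2 by mulby eI sg; mulby sg2 (r / 2); lra.
have : 0 < t * (sg * Im v) by rewrite E; lra.
by move=> E'; nra.
Qed.

Lemma left_end_rh A a v : L A -> unit_rhombus_at a 1 v A -> left_end a /\ left_end (a + v).
Proof.
by move=> LA hA; have [e1 _ _ e4] := rh_edges LA hA; split=> //; rewrite /Defs.edge; move: e4; rewrite addrAC.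
Qed.

(* [al n] is the left end of the tie between [F (n - 1)] and [F n]. *)
Definition track_through (al : int -> R[i]) (F : int -> set R[i]) : Prop :=
  forall n, [/\ L (F n), unit_rhombus_at (al n) 1 (al (n + 1) - al n) (F n) &
                0 < Im (al (n + 1) - al n)].

Lemma track_ex a : left_end a -> exists al F, al 0 = a /\ track_through al F.
Proof.
move=> la.
have /choice[up hup] : forall a, exists b, left_end a -> left_end b /\
    exists A, [/\ L A, unit_rhombus_at a 1 (b - a) A & 0 < Im (b - a)].
  move=> b; have [lb|nlb] := pselect (left_end b); last by exists b.
  have [|A [v [LA hA v0]]] := @unit_face 1 b _ lb; first by rewrite expr1n.
  exists (b + v) => _; split; first by case: (left_end_rh LA hA).
  by exists A; rewrite addrAC subrr add0r; split; rewrite // -[Im v]mul1r.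
have /choice[dn hdn] : forall a, exists b, left_end a -> left_end b /\
    exists A, [/\ L A, unit_rhombus_at b 1 (a - b) A & 0 < Im (a - b)].
  move=> b; have [lb|nlb] := pselect (left_end b); last by exists b.
  have [|A [v [LA hA v0]]] := @unit_face (-1) b _ lb; first by rewrite sqrrN expr1n.
  exists (b + v) => _; split; first by case: (left_end_rh LA hA).
  exists A; rewrite opprD addrA subrr add0r ImN; split=> //; last by rewrite -mulN1r.
  exact: rh_swap (rh_flip (rh_swap hA)).
(* [Negz k] is -(k + 1), hence the additional step down. *)
pose al (n : int) := match n with Posz k => iter k up a | Negz k => iter k.+1 dn a end.
have lup k : left_end (iter k up a) by elim: k => //= k IH; case: (hup _ IH).
have ldn k : left_end (iter k dn a) by elim: k => //= k IH; case: (hdn _ IH).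
have step n : exists A, [/\ L A, unit_rhombus_at (al n) 1 (al (n + 1) - al n) A &
    0 < Im (al (n + 1) - al n)].
  case: n => k; first by rewrite (_ : k%:Z + 1 = k.+1) /=; [have [] := hup _ (lup k)|lia].
  have -> : al (Negz k + 1) = iter k dn a.
    by case: k => // k; rewrite (_ : Negz k.+1 + 1 = Negz k) //; lia.
  by rewrite /=; have [] := hdn _ (ldn k).
have [F hF] := choice step.
by exists al, F.
Qed.

Lemma track_left al F n : track_through al F -> left_end (al n).
Proof. by move=> /(_ n)[LF hF _]; case: (left_end_rh LF hF). Qed.

(** With one side equal to 1 the determinant of a face is its height. A height is at most 1, so it
    is at least its square and hence at least the constant [k] of [cross_bound]: the track is
    unbounded both ways. *)
Lemma track_reach al F (y : R) : track_through al F -> exists n, Im (al n) <= y <= Im (al (n + 1)).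
Proof.
move=> tr; have [k k0 hk] := cross_bound latL.
have step n : Im (al n) + k <= Im (al (n + 1)).
  have [LF hF v0] := tr n; have := hk _ _ _ _ LF hF.
  have /norm1P := rh_nv hF.
  move: v0; rewrite /cross /= mul1r mul0r subr0 !reimE.
  set V := Im (al (n + 1)) - _ => V0 nv kV.
  have := sqr_ge0 (Re (al (n + 1)) - Re (al n)) => X0.
  have V1 : V <= 1 by rewrite leNgt; apply/negP => V1; nra.
  have : k <= V by nra.
  rewrite /V; lra.
have up (j : nat) n : Im (al n) + j%:R * k <= Im (al (n + j%:Z)).
  elim: j n => [|j IH] n; first by rewrite mul0r !addr0.
  rewrite (_ : n + j.+1%:Z = n + j%:Z + 1); last lia.
  by apply: le_trans (step _); have := IH n; rewrite mulrSr mulrDl; lra.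
have find (j : nat) n : Im (al n) <= y -> y <= Im (al (n + j%:Z)) ->
    exists n, Im (al n) <= y <= Im (al (n + 1)).
  elim: j n => [|j IH] n h1 h2.
    exists n; rewrite h1 (le_trans h2) // addr0; have := step n; lra.
  have [h3|h3] := leP y (Im (al (n + 1))); first by exists n; rewrite h1.
  apply: (IH (n + 1)); first exact: ltW.
  by move: h2; rewrite (_ : n + j.+1%:Z = n + 1 + j%:Z) //; lia.
have hM := archi_boundP (normr_ge0 ((y - Im (al 0)) / k)).
set N := Num.bound _ in hM.
have hN : `|y - Im (al 0)| <= N%:R * k.
  by rewrite -ler_pdivrMr // -[X in _ / X](gtr0_norm k0) -normf_div ltW.
move: hN; rewrite ler_norml => /andP[h1 h2].
apply: (find (N + N)%N (- N%:Z)).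
  by have := up N (- N%:Z); rewrite addNr; lra.
have := up N 0; rewrite add0r (_ : - N%:Z + (N + N)%N = N); last lia.
lra.
Qed.

Section Level.
Variable h : R[i] -> int.
Hypothesis hE : forall x y, edge L x y -> h y = h x + jump (y - x).
Local Notation hR x := ((h x)%:~R : R).

Lemma face_step_nonunit A a v : L A -> unit_rhombus_at a 1 v A ->
  nonunit_edge L a (a + v) /\ nonunit_edge L (a + 1) (a + 1 + v).
Proof.
move=> LA hA; have [_ e2 e3 _] := rh_edges LA hA; have [v1 v2] := rh1_v hA.
by split; split=> //; rewrite addrAC subrr add0r.
Qed.

Lemma track_level al F n : track_through al F -> h (al n) = h (al 0).
Proof.
move=> tr; have step m : h (al (m + 1)) = h (al m).
  have [LF hF _] := tr m; have [ne _] := face_step_nonunit LF hF.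
  by have := h_nonunit hE ne; rewrite (addrC (al m)) subrK.
by elim/int_ind2: n => // n; rewrite step.
Qed.

(** On the middle line of a face with horizontal sides the interpolation is the level plus 1/2, and
    just to the right it is larger. Monotonicity leaves at most one such point on each horizontal
    line. *)
Lemma center_inj A a v t A' a' v' t' : L A -> unit_rhombus_at a 1 v A -> 0 <= t <= 1 ->
  L A' -> unit_rhombus_at a' 1 v' A' -> 0 <= t' <= 1 -> h a = h a' ->
  Im (pt a 1 v 2^-1 t) = Im (pt a' 1 v' 2^-1 t') ->
  pt a 1 v 2^-1 t = pt a' 1 v' 2^-1 t'.
Proof.
have main B b w s B' b' w' s' : L B -> unit_rhombus_at b 1 w B -> 0 <= s <= 1 ->
    L B' -> unit_rhombus_at b' 1 w' B' -> 0 <= s' <= 1 -> h b = h b' ->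
    Im (pt b 1 w 2^-1 s) = Im (pt b' 1 w' 2^-1 s') ->
    Re (pt b 1 w 2^-1 s) < Re (pt b' 1 w' 2^-1 s') -> False.
  move=> LB hB hs LB' hB' hs' hh eI lt.
  (* A shift to the right by [eps] neither leaves the face nor passes the other point. *)
  pose eps := Num.min 2^-1 (Re (pt b' 1 w' 2^-1 s') - Re (pt b 1 w 2^-1 s)).
  have e1 : eps <= 2^-1 by rewrite /eps ge_min lexx.
  have e2 : eps <= Re (pt b' 1 w' 2^-1 s') - Re (pt b 1 w 2^-1 s) by rewrite /eps ge_min lexx orbT.
  have e0 : 0 < eps by rewrite lt_min; apply/andP; split; lra.
  have h1 : interp L h (pt b 1 w (2^-1 + eps) s) (hR b + (2^-1 + eps)) by apply: (interp_unit_face h LB hB); lra.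
  have h2 : interp L h (pt b' 1 w' 2^-1 s') (hR b' + 2^-1) by apply: (interp_unit_face h LB' hB'); lra.
  have := interp_mono latL hE _ _ h1 h2; rewrite hh => H.
  suff : (h b')%:~R + (2^-1 + eps) <= (h b')%:~R + 2^-1 by lra.
  apply: H; first by rewrite -eI /pt !reimE /=; lra.
  by move: e2; rewrite /pt !reimE /=; lra.
move=> LA hA ht LA' hA' ht' hh eI; apply: eqcP => //.
case: (ltgtP (Re (pt a 1 v 2^-1 t)) (Re (pt a' 1 v' 2^-1 t'))) => // lt; exfalso.
  exact: (main A a v t A' a' v' t').
exact: (main A' a' v' t' A a v t).
Qed.

(** By [center_inj] the midpoint of the edge at [d] is the point of the middle line of the track at
    that height, so the edge is a side of a face of the track. *)
Lemma on_track al F d : track_through al F -> left_end d -> h d = h (al 0) ->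
  exists n, d = al n.
Proof.
move=> tr [A LA sA] hd.
have a1 : d + 1 - d = 1 by rewrite addrAC subrr add0r.
have [n hn] := track_reach (Im d) tr.
have [LF hF v0] := tr n.
have [w hA] := sA; rewrite a1 in hA.
move: hn; set v := al (n + 1) - al n in hF v0.
have alE : al (n + 1) = al n + v by rewrite /v (addrC (al n)) subrK.
rewrite alE ImD => hn; clearbody v.
pose t := (Im d - Im (al n)) / Im v.
have ht : 0 <= t <= 1.
  apply/andP; split; first by apply: divr_ge0; lra.
  by rewrite ler_pdivrMr // mul1r; lra.
have tE : t * Im v = Im d - Im (al n) by rewrite /t divfK // gt_eqF.
have E : pt (al n) 1 v 2^-1 t = pt d 1 w 2^-1 0.
  apply: center_inj LF hF ht LA hA _ _ _; first lra.
    by rewrite (track_level n tr) hd.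
  by rewrite /pt !reimE tE /=; lra.
have Fp : F n (d + (2^-1 : R)%:C * (d + 1 - d)).
  by rewrite (seg_pt _ _ _ w) a1 -E; apply: (rh_pt hF); lra.
have [|w' hF'] := side_shared latL LA sA _ LF Fp; first lra.
rewrite a1 in hF'.
have cd : corner (F n) d by exists 1, w'.
case: (corner4 hF cd) => dE.
- by exists n.
(* If [d] were a right corner, the midpoint of its edge would have first coordinate 3/2. *)
- have : pt (al n) 1 v 2^-1 t = pt (al n) 1 v (1 + 2^-1) 0.
    by rewrite E dE /pt; apply: eqcP; rewrite !reimE /=; ring.
  by move=> /(pt_inj (rh_cross hF))[]; lra.
- by exists (n + 1); rewrite alE.
- have : pt (al n) 1 v 2^-1 t = pt (al n) 1 v (1 + 2^-1) 1.
    by rewrite E dE /pt; apply: eqcP; rewrite !reimE /=; ring.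
  by move=> /(pt_inj (rh_cross hF))[]; lra.
Qed.

(** In a face with horizontal sides, each of the other two sides joins the two corners of one level;
    a face without them has only usable sides. *)
Lemma face_nconn A x y : L A -> corner A x -> corner A y -> h x = h y -> nconn x y.
Proof.
move=> LA cx cy.
case: (face_kind latL LA) => [[a [v hA]]|nA].
  have [e1 e2] := face_step_nonunit LA hA.
  have [ua _] := left_end_rh LA hA; have hl := h_left hE ua.
  have h1 := h_nonunit hE e1; have h2 := h_nonunit hE e2.
  have c1 := conn_edge e1; have c2 := conn_edge e2.
  have c1' := nconn_sym c1; have c2' := nconn_sym c2.
  case: (corner4 hA cx) => ->; case: (corner4 hA cy) => ->; rewrite ?h1 ?h2 ?hl => e;
    first [exact: conn_refl|assumption|exfalso; lia].
have [u [v hA]] := cx.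
have [u1 u2 v1 v2] := nA _ _ _ hA.
have [e1 e2 e3 e4] := rh_edges LA hA.
have addlK (c d : R[i]) : c + d - c = d by rewrite addrAC subrr add0r.
have c1 : nconn x (x + u) by apply: conn_edge; split; rewrite // addlK.
have c2 : nconn x (x + v) by apply: conn_edge; split; rewrite // addlK.
have c3 : nconn (x + u) (x + u + v) by apply: conn_edge; split; rewrite // addlK.
case: (corner4 hA cy) => -> _ //; first exact: conn_refl.
exact: conn_trans c1 c3.
Qed.

(** The upper bound keeps [eta] below [n + 1], so left ends have level [n], except when [eta = n] is
    attained on the right side of a face, whose corners then have level [n]. *)
Lemma level_corner z n eta : interp L h z eta -> n%:~R <= eta <= n%:~R + 2^-1 ->
  exists c, h c = n /\ forall A, L A -> A z -> corner A c.
Proof.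
move=> hz hn.
have [A LA Az] := lat_cover latL z.
case: (lat_cell latL z) => [cor|[x [y [t [ht zE sd]]]]|uniq].
- exists z; split=> //.
  have vz : vertices L z by exists A => //; apply: cor.
  have := interp_uniq latL hE hz (interp_vertex h vz) => e.
  by apply: (@int_between R); lra.
- have sA := sd A LA Az; have [w hA] := sA.
  have exy : edge L x y by exists A.
  have := interp_pt h LA hA (s := t) (t := 0); rewrite -seg_pt -zE.
  have [t01 z01] : 0 <= t <= 1 /\ 0 <= (0 : R) <= 1 by split; lra.
  move=> /(_ t01 z01) /(interp_uniq latL hE hz); rewrite /interp_at mul0r addr0 => eE.
  have [d1|d1] := eqVneq (y - x) 1.
    exists x; split; last by move=> B LB Bz; apply: side_corner (sd B LB Bz).
    apply: (@int_between R); rewrite d1 jump1 in eE; lra.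
  have [d2|d2] := eqVneq (y - x) (-1).
    exists y; split; last by move=> B LB Bz; apply: side_corner (side_sym (sd B LB Bz)).
    apply: (@int_between R); rewrite (hE exy) d2 jumpN jump1 intrD in eE *; lra.
  exists x; split; last by move=> B LB Bz; apply: side_corner (sd B LB Bz).
  apply: (@int_between R); rewrite jump0 // in eE; lra.
- have [c [hc cA]] : exists c, h c = n /\ corner A c; last first.
    by exists c; split=> // B LB Bz; rewrite (uniq B A).
  case: (face_kind latL LA) => [[a [v hA]]|nA].
    have [c1 c2 _ _] := corner_rh hA.
    move: Az => /(rhP hA)[s [t [hs ht zE]]].
    have := interp_unit_face h LA hA hs ht; rewrite -zE => /(interp_uniq latL hE hz) e.
    have [le|lt] := leP n%:~R (hR a).
      by exists a; split=> //; apply: (@int_between R); lra.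
    have [ua _] := left_end_rh LA hA.
    exists (a + 1); split=> //; rewrite (h_left hE ua).
    by apply: (@int_between R); rewrite intrD; lra.
  have [a [u [v hA]]] := lat_rh latL LA.
  exists a; split; last by exists u, v.
  by apply: (@int_between R); have := interp_nonunit_face latL hE LA nA hA Az hz; lra.
Qed.

(** Follow the horizontal segment from [x] to the point [p] of the middle line of the track. By
    monotonicity the interpolation stays between [h x] and [h x + 1/2], so [level_corner] supplies
    intermediate vertices of level [h x]. *)
Lemma to_left_end x a0 : vertices L x -> left_end a0 -> h a0 = h x ->
  exists a, [/\ left_end a, h a = h x & nconn x a].
Proof.
move=> vx la0 ha0.
have [al [F [al0 tr]]] := track_ex la0.
have [k hk] := track_reach (Im x) tr.
have [LF hF v0] := tr k.
have hal : h (al k) = h x by rewrite (track_level k tr) al0.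
exists (al k); split=> //; first exact: track_left tr.
set v := al (k + 1) - al k in hF v0.
have alE : al (k + 1) = al k + v by rewrite /v (addrC (al k)) subrK.
rewrite alE ImD in hk; clearbody v.
pose t := (Im x - Im (al k)) / Im v.
have ht : 0 <= t <= 1.
  apply/andP; split; first by apply: divr_ge0; lra.
  by rewrite ler_pdivrMr // mul1r; lra.
have tE : t * Im v = Im x - Im (al k) by rewrite /t divfK // gt_eqF.
pose p := pt (al k) 1 v 2^-1 t.
have pI : Im p = Im x by rewrite /p /pt !reimE tE /=; lra.
have Fp : F k p by apply: (rh_pt hF) => //; lra.
have hp : interp L h p (hR x + 2^-1).
  by rewrite -hal; apply: (interp_unit_face h LF hF) => //; lra.
have hx := interp_vertex h vx.
have le : Re x <= Re p.
  rewrite leNgt; apply/negP => lt.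
  by have := interp_mono latL hE pI (ltW lt) hp hx; lra.
have lev z eta : box (Re x) (Re p) (Im x) (Im x) z -> interp L h z eta ->
    (h x)%:~R <= eta <= (h x)%:~R + 2^-1.
  move=> [z1 z2] hz; have Iz : Im z = Im x by lra.
  apply/andP; split.
    by apply: (interp_mono latL hE _ _ hx hz); [rewrite Iz|lra].
  by apply: (interp_mono latL hE _ _ hz hp); [rewrite Iz|lra].
have [r r0 hr] := lebesgue_number latL (Re x) (Re p) (Im x) (Im x).
pose E q q' := forall A B y y', L A -> L B -> A q -> B q' -> corner A y -> corner B y' ->
  h y = h x -> h y' = h x -> nconn y y'.
have [A LA cA] := vx.
have xK : box (Re x) (Re p) (Im x) (Im x) x by split; lra.
have pK : box (Re x) (Re p) (Im x) (Im x) p by split; lra.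
apply: (@midpoint_ind _ _ _ _ _ r E r0 _ _ x p xK pK A (F k)) => //.
- move=> q q' Kq Kq' cl B C y y' LB LC Bq Cq' cy cy' hy hy'.
  have [z Kz hz] := hr q Kq.
  have [eta heta] := interp_ex latL h z.
  have [c [hc cc]] := level_corner heta (lev _ _ Kz heta).
  have Bc : corner B c by apply: cc => //; apply: (hz B q) => //; apply: sup_close_refl.
  have Cc : corner C c by apply: cc => //; apply: (hz C q').
  apply: (@conn_trans _ _ _ c).
    by apply: face_nconn LB cy Bc _; rewrite hy hc.
  by apply: face_nconn LC Cc cy' _; rewrite hy' hc.
- move=> q q' Kq Kq' E1 E2 B C y y' LB LC Bq Cq' cy cy' hy hy'.
  have Km := box_midpoint Kq Kq'.
  have [eta heta] := interp_ex latL h (midpoint q q').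
  have [c [hc cc]] := level_corner heta (lev _ _ Km heta).
  have [G LG Gm] := lat_cover latL (midpoint q q').
  have Gc := cc G LG Gm.
  exact: conn_trans (E1 B G y c LB LG Bq Gm cy Gc hy hc) (E2 G C c y' LG LC Gm Cq' Gc cy' hc hy').
- exact: corner_in.
- by exists 1, v.
Qed.

End Level.
End Tracks.

(** * Left ends at every level from coherent tracks *)

Section Coherent.
Variables (R : realType) (L : set (set R[i])).
Implicit Types (a b c d e u v w x y z p q : R[i]) (A B : set R[i]) (s t r : R).
Hypothesis latL : rhombic_lattice L.

Lemma tie_sym (F : int -> set R[i]) a b : tie F a b -> tie F b a.
Proof. by move=> [n [s1 s2]]; exists n; split; apply: side_sym. Qed.

Section OneTrack.
Variables (al : int -> R[i]) (F : int -> set R[i]).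
Hypothesis tr : track_through L al F.

Let alS n : al (n + 1) = al n + (al (n + 1) - al n).
Proof. by rewrite (addrC (al n)) subrK. Qed.

Lemma track_bottom n : side (F n) (al n) (al n + 1).
Proof. by have [_ hF _] := tr n; apply: side_rh hF. Qed.

Lemma track_top n : side (F n) (al (n + 1)) (al (n + 1) + 1).
Proof.
have [_ hF _] := tr n.
by rewrite alS; apply: side_rh (rh_swap (rh_flip (rh_swap hF))).
Qed.

Lemma track_tie n : tie F (al n) (al n + 1).
Proof.
exists (n - 1); rewrite subrK; split; last exact: track_bottom.
by have := track_top (n - 1); rewrite subrK.
Qed.

Lemma track_through_track : track L F.
Proof.
have addlK (c d : R[i]) : c + d - c = d by rewrite addrAC subrr add0r.
split.
- by move=> n; case: (tr n).
(* The corner [al n] of [F n] lies below all of [F (n + 1)]. *)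
- move=> n E; have [_ hF1 _] := tr n; have [_ hF2 v2] := tr (n + 1).
  have : F (n + 1) (al n) by rewrite -E; apply: corner_in; exists 1, (al (n + 1) - al n).
  move=> /(rhP hF2)[s [t [hs ht e]]].
  have [_ _ v1] := tr n.
  have := congr1 (@complex.Im R) e.
  move: v1 v2; rewrite /pt !reimE /=.
  by set V1 := Im (al (n + 1)); set V2 := Im (al (n + 1 + 1)) => ? ? ?; clear E; nra.
- move=> n; exists (al n), (al n + 1), (al (n + 1)), (al (n + 1) + 1); split.
  + split; first by rewrite addlK; case: (tr n).
    by rewrite addlK.
  + by have := track_top (n - 1); rewrite subrK.
  + exact: track_bottom.
Qed.
End OneTrack.

Variable h : R[i] -> int.
Hypothesis hE : forall x y, edge L x y -> h y = h x + jump (y - x).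

(** Levels change by at most one per edge, and they drop only along edges of direction -1. The
    relation [e] will be all edges, or the edges that are not ties of a track. *)
Lemma cross_level (e : R[i] -> R[i] -> Prop) x ps n : (forall y z, e y z -> edge L y z) ->
  epath e x ps -> n < h x -> h (last x ps) <= n -> exists c, h c = n /\ e (c + 1) c.
Proof.
move=> he; elim: ps x => [|z ps IH] x /=; first lia.
rewrite /epath /= => /andP[/asboolP xz hp] hx hl.
have [hz|hz] := leP (h z) n; last exact: IH hp _ _.
have hj := hE (he _ _ xz).
have [j1|j1] := eqVneq (z - x) 1; first by rewrite j1 jump1 in hj; lia.
have [j2|j2] := eqVneq (z - x) (-1); last by rewrite jump0 // in hj; lia.
rewrite j2 jumpN jump1 in hj.
exists z; split; first lia.
by rewrite (_ : z + 1 = x) //; apply/eqP; rewrite -subr_eq0 addrAC j2 addNr.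
Qed.

Hypothesis dir1 : edge_directions L 1.
Hypothesis cohL : coherent_tracks_on_both_sides L.

Lemma edge_vertex x y : edge L x y -> vertices L x.
Proof. by move=> [A LA sA]; exists A => //; apply: side_corner sA. Qed.

Lemma epath_val (e : vertices L -> vertices L -> Prop) (e' : R[i] -> R[i] -> Prop)
    (a : vertices L) (ps : seq (vertices L)) :
  (forall i j, e i j -> e' (val i) (val j)) ->
  path (fun i j => `[< e i j >]) a ps -> epath e' (val a) (map val ps).
Proof.
move=> he; elim: ps a => //= j ps IH i /andP[/asboolP ab hp].
by rewrite /epath /=; apply/andP; split; [apply/asboolP/he|apply: IH].
Qed.

(** A left end at or above the level of [x] suffices: a path from it down to [x] crosses the level
    ([key]). If the given one is lower, a coherent track on the upper side of a track of level
    [h x - 1] provides one. *)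
Lemma left_end_level x : vertices L x -> exists a, left_end L a /\ h a = h x.
Proof.
move=> vx.
have [a0 la0] : exists a, left_end L a.
  case: dir1 => a [b [eab e]]; exists a; rewrite /left_end (_ : a + 1 = b) //.
  by rewrite e addrC subrK.
have key a : left_end L a -> h x <= h a -> exists a, left_end L a /\ h a = h x.
  move=> la; rewrite le_eqVlt => /orP[/eqP e|lt]; first by exists a.
  have [ps hp hl] := lattice_conn latL (edge_vertex la) vx.
  have [//||c [hc ec]] := cross_level _ hp lt; first by rewrite hl.
  by exists c; split=> //; apply: edge_sym.
have [le|lt] := leP (h x) (h a0); first exact: key le.
have [ps hp hl] := lattice_conn latL vx (edge_vertex la0).
have [//||| c [hc ec]] := cross_level (n := h x - 1) _ hp _ _; [lia|rewrite hl; lia|].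
have lc : left_end L c by apply: edge_sym.
have [al [F [al0 tr]]] := track_ex latL lc.
have vc : vertices L (c + 1) by apply: edge_vertex ec.
(* The right end [c + 1] of a tie has level [h x] and selects the side of the track that lies
   above. *)
pose a : vertices L := exist _ (c + 1) (mem_set vc).
have St : track_side F [set j | exists ps, path_from_to (@adjacent_off_ties R L F) a ps j].
  by exists a.
have [G [tG cG sG]] := cohL (track_through_track tr) St.
have [_ _ /(_ 0)[a' [b' [c' [d' [[opp _] sd _]]]]]] := tG.
have sd0 : side (G 0) a' b' by exists (c' - a').
have tg : tie G a' b' by exists (0 - 1); rewrite subrK.
have tF := track_tie tr 0.
have [k kE] := cG _ _ _ _ tF tg.
(* Ties of [G] are real multiples of 1 of length 1, so the factor [k] is 1 or -1. *)
have : exists d, left_end L d /\ corner (G 0) d.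
  have /norm1P := rh_nu opp; rewrite kE addrAC subrr add0r !reimE /= mulr1 mulr0 expr0n addr0.
  have LG : L (G 0) by case: tG.
  have eG : edge L a' b' by exists (G 0).
  move/eqP; rewrite sqrf_eq1 => /orP[/eqP k1|/eqP k1]; rewrite k1 in kE.
    exists a'; split; last exact: side_corner sd0.
    rewrite /left_end (_ : a' + 1 = b') //.
    by move: kE; rewrite addrAC subrr add0r mulr1 (rmorph1 (real_complex R)) => <-; rewrite addrC subrK.
  exists b'; split; last exact: side_corner (side_sym sd0).
  rewrite /left_end (_ : b' + 1 = a'); first exact: edge_sym.
  apply/eqP; rewrite -subr_eq0 addrAC kE addrAC subrr add0r mulr1.
  by rewrite rmorphN addNr.
move=> [d0 [ld0 cd0]].
have [le|lt'] := leP (h x) (h d0); first exact: key le.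
(* If [d0] were lower than [x], the path to it off the ties of [F] would descend to level [h x - 1]
   along a horizontal edge; by [on_track] that edge is a tie of [F]. *)
pose d0' : vertices L := exist _ d0 (mem_set (edge_vertex ld0)).
have [ps' [hp' hl']] := sG 0 d0' cd0.
have hp'' := @epath_val _ (fun x y => edge L x y /\ ~ tie F x y) _ _ _ hp'.
have [||||d [hd [ed ntd]]] := cross_level (n := h x - 1) _ (hp'' _) _ _.
- by move=> y z [].
- by move=> y z [].
- by rewrite /= (h_left hE lc); lia.
- by rewrite last_map hl' /=; lia.
have ld : left_end L d by apply: edge_sym.
have [|m dE] := on_track latL hE tr ld; first by rewrite al0 hd hc.
by case: ntd; apply: tie_sym; rewrite dE; apply: track_tie.
Qed.

Lemma conn_left_end x : vertices L x -> exists a, left_end L a /\ nconn L a x.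
Proof.
move=> vx; have [a0 [la0 ha0]] := left_end_level vx.
have [a [la ha c]] := to_left_end latL hE vx la0 ha0.
by exists a; split=> //; apply: nconn_sym.
Qed.

End Coherent.

(** * Transport of solutions along edges *)

Section LinearExpressions.
Variables (K : comNzRingType) (V : lmodType K).

(** Syntax for proof by reflection: [LV i] is the atom of index [i], and equality of coefficients is
    left to [ring] or [field]. *)
Inductive lexp := LV of nat | L0 | LA of lexp & lexp | LN of lexp | LS of K & lexp.

Fixpoint leval (vs : seq V) (e : lexp) : V :=
  match e with
  | LV i => vs`_i | L0 => 0 | LA e1 e2 => leval vs e1 + leval vs e2
  | LN e1 => - leval vs e1 | LS k e1 => k *: leval vs e1
  end.

Fixpoint lcoef (e : lexp) (i : nat) : K :=
  match e with
  | LV j => (j == i)%:R | L0 => 0 | LA e1 e2 => lcoef e1 i + lcoef e2 i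
  | LN e1 => - lcoef e1 i | LS k e1 => k * lcoef e1 i
  end.

Lemma levalE vs e : leval vs e = \sum_(i < size vs) lcoef e i *: vs`_i.
Proof.
elim: e => [j||e1 IH1 e2 IH2|e IH|k e IH] /=.
- have [lt|le] := ltnP j (size vs).
    rewrite (bigD1 (Ordinal lt)) //= eqxx scale1r big1 ?addr0 // => i /eqP ij.
    case: eqP => [ji|_]; last by rewrite scale0r.
    by case: ij; apply: val_inj.
  rewrite nth_default // big1 // => i _; rewrite (gtn_eqF (leq_trans (ltn_ord i) le)).
  by rewrite scale0r.
- by rewrite big1 // => i _; rewrite scale0r.
- by rewrite IH1 IH2 -big_split; apply: eq_bigr => i _; rewrite scalerDl.
- by rewrite IH -sumrN; apply: eq_bigr => i _; rewrite scaleNr.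
- by rewrite IH scaler_sumr; apply: eq_bigr => i _; rewrite scalerA.
Qed.

Fixpoint lcoef_eq (n : nat) (e1 e2 : lexp) : Prop :=
  if n is m.+1 then lcoef e1 m = lcoef e2 m /\ lcoef_eq m e1 e2 else True.

Lemma leval_eq vs e1 e2 : lcoef_eq (size vs) e1 e2 -> leval vs e1 = leval vs e2.
Proof.
move=> H; rewrite !levalE; apply: eq_bigr => i _; congr (_ *: _).
have : (i < size vs)%N by [].
elim: (size vs) H (nat_of_ord i) => // n IH [H1 H2] j; rewrite ltnS leq_eqVlt => /orP[/eqP -> //|].
exact: IH.
Qed.

Lemma lincomb1 (k : K) (P Q X Y : V) : P = Q -> X - Y = k *: (P - Q) -> X = Y.
Proof. by move=> ->; rewrite subrr scaler0 => /eqP; rewrite subr_eq0 => /eqP. Qed.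

End LinearExpressions.

Ltac lindex vs x :=
  lazymatch vs with
  | cons x _ => constr:(O)
  | cons _ ?tl => let n := lindex tl x in constr:(S n)
  end.

Ltac lreify K vs t :=
  lazymatch t with
  | @Algebra.add _ ?a ?b => let e1 := lreify K vs a in let e2 := lreify K vs b in
      constr:(@LA K e1 e2)
  | @Algebra.opp _ ?a => let e1 := lreify K vs a in constr:(@LN K e1)
  | @GRing.scale _ _ ?k ?a => let e1 := lreify K vs a in constr:(@LS K k e1)
  | @Algebra.zero _ => constr:(@L0 K)
  | ?x => let n := lindex vs x in constr:(@LV K n)
  end.

(* Reduces a linear identity between the vectors [vs] to identities between
   their coefficients. *)
Ltac linear_identity K V vs :=
  lazymatch goal with
  | |- ?X = ?Y => let e1 := lreify K vs X in let e2 := lreify K vs Y in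
      refine (@leval_eq K V vs e1 e2 _ : X = Y); simpl
  end.

(** * Polynomials with vector coefficients *)

Section PolynomialVectors.
Variables (K : fieldType) (V : lmodType K).

(** The value at [c] of a polynomial with coefficients in [V], encoded as a sum of scalar
    polynomials times vectors. *)
Definition polyvec (l : seq ({poly K} * V)) (c : K) : V :=
  \sum_(qv <- l) qv.1.[c] *: qv.2.

(** Each zero splits off a linear factor as for scalar polynomials; the induction is on a bound for
    the sizes, and [l'] collects the quotients. *)
Lemma polyvec_eq0 (nodes : nat -> K) (c : K) (l : seq ({poly K} * V)) :
  injective nodes -> (forall k, polyvec l (nodes k) = 0) -> polyvec l c = 0.
Proof.
move=> inj.
suff H n : forall l : seq ({poly K} * V), (forall qv, qv \in l -> size qv.1 <= n)%N ->
    (forall k, (k < n)%N -> polyvec l (nodes k) = 0) -> polyvec l c = 0.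
  move=> h; apply: (H (\max_(qv <- l) size qv.1)%N) => // qv hqv.
  exact: leq_bigmax_seq.
elim: n => [|n IH] {}l hs hz.
  rewrite /polyvec big_seq big1 // => qv /hs; rewrite leqn0 size_poly_eq0 => /eqP ->.
  by rewrite horner0 scale0r.
pose d := 'X - (nodes n)%:P.
pose l' := [seq (qv.1 %/ d, qv.2) | qv <- l].
have E x : polyvec l x = (x - nodes n) *: polyvec l' x + polyvec l (nodes n).
  rewrite /polyvec big_map scaler_sumr -big_split; apply: eq_bigr => qv _ /=.
  rewrite {1}(divp_eq qv.1 d) modp_XsubC !hornerE scalerDl scalerA.
  by rewrite mulrC.
have z0 := hz n (leqnn _).
rewrite E z0 addr0 IH ?scaler0 // => [qv /mapP[qv' /hs hq ->] /=|k kn].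
  by rewrite size_divp ?polyXsubC_eq0 // size_XsubC leq_subLR add1n.
have := hz k (ltnW kn); rewrite E z0 addr0 => /eqP; rewrite scaler_eq0 subr_eq0.
by rewrite (inj_eq inj) (ltn_eqF kn) /= => /eqP.
Qed.

End PolynomialVectors.

(** * Transport with a parameter *)

Section LambdaTransport.
Variables (R : realType) (V : lmodType R[i]) (L : set (set R[i])).
Hypothesis latL : rhombic_lattice L.
Variable g : R[i] -> V.
Hypothesis g_rh : forall A a u v, L A -> unit_rhombus_at a u v A ->
  (u + v) *: (g (a + u) - g (a + v)) = (u - v) *: (g (a + u + v) - g a).
Implicit Types (a b e u v x y : R[i]).

(* Solves (1 + l e) f(a) - (1 - l e) f(b) = 2 (g(b) - g(a)), with e = b - a, for
   [f b] given [f a = xi]. *)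
Definition step (l : R[i]) a b (xi : V) : V :=
  (1 - l * (b - a))^-1 *: ((1 + l * (b - a)) *: xi - 2 *: (g b - g a)).

Lemma step_inv l a b xi : 1 - l * (b - a) != 0 -> 1 + l * (b - a) != 0 ->
  step l b a (step l a b xi) = xi.
Proof.
rewrite /step => h1 h2.
have E : 1 - l * (a - b) = 1 + l * (b - a) by ring.
rewrite E (_ : l * (a - b) = - (l * (b - a))); last by ring.
move: h1 h2; move: (l * (b - a)) => k h1 h2.
linear_identity R[i] V [:: xi; g a; g b].
by repeat split; field; rewrite h1 h2.
Qed.

(** The two sides differ by a multiple of the relation [g_rh], so the discrete analyticity of [g]
    makes the transport flat. *)
Lemma step_rh l A a u v xi : L A -> unit_rhombus_at a u v A ->
  1 - l * u != 0 -> 1 - l * v != 0 ->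
  step l (a + u) (a + u + v) (step l a (a + u) xi) =
  step l (a + v) (a + u + v) (step l a (a + v) xi).
Proof.
move=> LA hA h1 h2; rewrite /step.
have addlK (c d : R[i]) : c + d - c = d by rewrite addrAC subrr add0r.
rewrite !addlK (_ : a + u + v - (a + v) = u); last by ring.
apply: (lincomb1 (k := - (2 * l / ((1 - l * u) * (1 - l * v)))) (g_rh LA hA)).
linear_identity R[i] V [:: xi; g a; g (a + u); g (a + v); g (a + u + v)].
by repeat split; field; rewrite h1 h2.
Qed.

Lemma edge_norm a b : edge L a b -> `|b - a| = 1.
Proof. by move=> [A _ [v hA]]; apply: rh_nu hA. Qed.

(** The shift by 2 keeps the nodes strictly between 0 and 1, where [1 - l * e] and [1 + l * e]
    cannot vanish for [e] of norm 1. *)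
Definition node (k : nat) : R[i] := k.+2%:R^-1.

Lemma node_inj : injective node.
Proof.
by move=> i j /invr_inj/eqP; rewrite eqr_nat => /eqP[].
Qed.

Lemma node_neq0 k a b : edge L a b -> 1 - node k * (b - a) != 0 /\ 1 + node k * (b - a) != 0.
Proof.
move=> /edge_norm ne.
have nk : `|node k * (b - a)| != 1.
  rewrite normrM ne mulr1 normfV normr_nat invr_eq1.
  by rewrite -[1]/(1%:R) eqr_nat.
split; apply: contraNneq nk => e.
  have -> : node k * (b - a) = 1 by apply/esym/eqP; rewrite -subr_eq0 e.
  by rewrite normr1.
have -> : node k * (b - a) = -1 by apply/eqP; rewrite -addr_eq0 addrC e.
by rewrite normrN normr1.
Qed.

Lemma node_path_indep k a (p q : seq R[i]) xi : vertices L a -> epath (edge L) a p ->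
  epath (edge L) a q -> last a p = last a q ->
  transport (step (node k)) a p xi = transport (step (node k)) a q xi.
Proof.
apply: (path_indep latL).
- by move=> x y zeta /(node_neq0 k)[h1 h2]; apply: step_inv.
- move=> A x u v zeta LA hA; apply: (step_rh _ LA hA).
    by have [e1 _ _ _] := rh_edges LA hA; have [+ _] := node_neq0 k e1; rewrite addrAC subrr add0r.
  by have [_ e1 _ _] := rh_edges LA hA; have [+ _] := node_neq0 k e1; rewrite addrAC subrr add0r.
Qed.

Fixpoint denom a (p : seq R[i]) : {poly R[i]} :=
  if p is b :: q then (1 - (b - a) *: 'X) * denom b q else 1.

Lemma transport_rational a (p : seq R[i]) xi : exists N : seq ({poly R[i]} * V),
  forall l, (denom a p).[l] != 0 ->
    (denom a p).[l] *: transport (step l) a p xi = polyvec N l.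
Proof.
(* For the induction the initial value is itself rational in [l], with numerator [N0] and
   denominator [D0]. *)
suff H : forall (D0 : {poly R[i]}) (N0 : seq ({poly R[i]} * V)), exists N,
    forall l zeta, D0.[l] *: zeta = polyvec N0 l -> (denom a p).[l] != 0 ->
    (D0 * denom a p).[l] *: transport (step l) a p zeta = polyvec N l.
  have [N hN] := H 1 [:: (1, xi)]; exists N => l hl.
  by have := hN l xi; rewrite mul1r; apply; rewrite // /polyvec big_seq1.
elim: p a => [|b p IH] a D0 N0 /=.
  by exists N0 => l zeta <- _; rewrite mulr1.
set e := b - a.
pose N1 := [seq ((1 + e *: 'X) * qv.1, qv.2) | qv <- N0] ++ [:: (- 2 *: D0, g b - g a)].
have [N hN] := IH b (D0 * (1 - e *: 'X)) N1.
exists N => l zeta hz; rewrite hornerM mulf_eq0 negb_or => /andP[h1 h2].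
rewrite mulrA; apply: hN => //.
have E1 : (1 - e *: 'X).[l] = 1 - l * e by rewrite !hornerE mulrC.
rewrite E1 in h1; rewrite hornerM E1 /step -/e.
rewrite /polyvec big_cat big_map big_seq1 /=.
rewrite (eq_bigr (fun qv => (1 + l * e) *: (qv.1.[l] *: qv.2))); last first.
  by move=> qv _; rewrite hornerM scalerA !hornerE [e * l]mulrC.
rewrite -scaler_sumr -/(polyvec N0 l) -hz hornerZ.
linear_identity R[i] V [:: zeta; g b; g a].
by repeat split; field.
Qed.

Lemma denom_neq0 (P : R[i] -> R[i] -> Prop) l a (p : seq R[i]) :
  (forall x y, P x y -> 1 - l * (y - x) != 0) -> epath P a p -> (denom a p).[l] != 0.
Proof.
move=> h; elim: p a => [|b p IH] a /=; first by rewrite hornerE oner_eq0.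
rewrite /epath /= => /andP[/asboolP ab /IH h2].
by rewrite hornerM mulf_eq0 negb_or h2 !hornerE mulrC h.
Qed.

Lemma epath_sub (P Q : R[i] -> R[i] -> Prop) a (p : seq R[i]) :
  (forall x y, P x y -> Q x y) -> epath P a p -> epath Q a p.
Proof. by move=> PQ; apply: sub_path => x y /asboolP /PQ ?; apply/asboolP. Qed.

(* Transport at parameter [l] depends rationally on [l], and at the nodes it is
   path independent by simple connectedness of the whole lattice; this extends
   to [l = 1] as long as no edge of the paths is a pole. *)
Lemma nonunit_path_indep a (p q : seq R[i]) xi : vertices L a ->
  epath (nonunit_edge L) a p -> epath (nonunit_edge L) a q -> last a p = last a q ->
  transport (step 1) a p xi = transport (step 1) a q xi.
Proof.
move=> va hp hq E.
have sub x y : nonunit_edge L x y -> edge L x y by case.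
have hp' := epath_sub sub hp; have hq' := epath_sub sub hq.
have [Np hNp] := transport_rational a p xi; have [Nq hNq] := transport_rational a q xi.
(* The difference of the two transports after cross-multiplication: it vanishes at all nodes, hence
   at 1, where both denominators are nonzero. *)
pose l := [seq (denom a q * nv.1, nv.2) | nv <- Np] ++
          [seq (- denom a p * nv.1, nv.2) | nv <- Nq].
have lE c : polyvec l c = (denom a q).[c] *: polyvec Np c - (denom a p).[c] *: polyvec Nq c.
  rewrite /polyvec big_cat !big_map /=; congr (_ + _).
    by rewrite scaler_sumr; apply: eq_bigr => nv _; rewrite hornerM scalerA.
  rewrite scaler_sumr -sumrN; apply: eq_bigr => nv _.
  by rewrite hornerM hornerN mulNr scaleNr scalerA.
have dn k (r : seq R[i]) : epath (edge L) a r -> (denom a r).[node k] != 0.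
  by apply: denom_neq0 => x y /(node_neq0 k)[].
have d1 (r : seq R[i]) : epath (nonunit_edge L) a r -> (denom a r).[1] != 0.
  by apply: denom_neq0 => x y [_ h _]; rewrite mul1r subr_eq0 eq_sym.
have : polyvec l 1 = 0.
  apply: (polyvec_eq0 _ node_inj) => k; rewrite lE -hNp ?dn // -hNq ?dn // !scalerA.
  by rewrite (node_path_indep k xi va hp' hq' E) mulrC subrr.
rewrite lE -hNp ?d1 // -hNq ?d1 // !scalerA [X in _ - X *: _]mulrC -scalerBr.
have dd : (denom a q).[1] * (denom a p).[1] != 0 by rewrite mulf_neq0 ?d1.
by move/eqP; rewrite scaler_eq0 (negbTE dd) subr_eq0 => /eqP.
Qed.

End LambdaTransport.

(** * The forward shift *)

Section Shift.
Variables (R : realType) (V : lmodType R[i]) (L : set (set R[i])).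
Hypothesis latL : rhombic_lattice L.
Implicit Types (a b e u v x y : R[i]).

Let addlK (c d : R[i]) : c + d - c = d.
Proof. by rewrite addrAC subrr add0r. Qed.

(** The discrete Cauchy-Riemann equation: up to a factor 2 and rearrangement, the integral of [g]
    around one rhombus vanishes. *)
Definition rhombic_DA (g : R[i] -> V) : Prop :=
  forall A a u v, L A -> unit_rhombus_at a u v A ->
  (u + v) *: (g (a + u) - g (a + v)) = (u - v) *: (g (a + u + v) - g a).

Section Solve.
Variable g : R[i] -> V.
Hypothesis g_rh : rhombic_DA g.
Hypothesis dir1 : edge_directions L 1.
Hypothesis cohL : coherent_tracks_on_both_sides L.

Definition carries a (xi : V) x (eta : V) : Prop := exists p : seq R[i],
  [/\ epath (nonunit_edge L) a p, last a p = x & eta = transport (step g 1) a p xi].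

Lemma carries_refl a xi : carries a xi a xi.
Proof. by exists [::]. Qed.

Lemma carries_trans a xi b eta c zeta :
  carries a xi b eta -> carries b eta c zeta -> carries a xi c zeta.
Proof.
move=> [p [hp lp ->]] [q [hq lq ->]]; exists (p ++ q); split.
- by rewrite /epath cat_path lp; apply/andP.
- by rewrite last_cat lp.
- by rewrite transport_cat lp.
Qed.

Let G a := g (a + 1) - g a.

(** [G] is the value that the equation forces at a left end. Its compatibility with transport across
    a face of a track is the relation [g_rh] for that face. *)
Lemma carries_face A a v : L A -> unit_rhombus_at a 1 v A -> carries a (G a) (a + v) (G (a + v)).
Proof.
move=> LA hA; exists [:: a + v]; split=> //.
  have [ne _] := face_step_nonunit LA hA.
  by rewrite /epath /= andbT; apply/asboolP.
have [v1 _] := rh1_v hA.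
have d0 : 1 - v != 0 by rewrite subr_eq0 eq_sym.
rewrite /= /step /G addlK mul1r; apply/esym.
rewrite (addrAC a v 1); apply: (lincomb1 (k := (1 - v)^-1) (g_rh LA hA)).
move: (g (a + 1 + v)) (g (a + v)) (g (a + 1)) (g a) => g3 g2 g1 g0.
linear_identity R[i] V [:: g0; g1; g2; g3].
by repeat split; field.
Qed.

Lemma carries_track al F n : track_through L al F ->
  carries (al 0) (G (al 0)) (al n) (G (al n)).
Proof.
move=> tr; elim/int_ind2: n => [|n IH|n IH]; first exact: carries_refl.
  have [LF hF _] := tr n; apply: carries_trans IH _.
  by have := carries_face LF hF; rewrite (addrC (al n)) subrK.
have [LF hF _] := tr n; apply: carries_trans IH _.
have := carries_face LF (rh_swap (rh_flip (rh_swap hF))).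
by rewrite (addrC (al n)) subrK opprB (addrC (al (n + 1))) subrK.
Qed.

Variable h : R[i] -> int.
Hypothesis hE : forall x y, edge L x y -> h y = h x + jump (y - x).

Lemma nonunit_level a (p : seq R[i]) : epath (nonunit_edge L) a p -> h (last a p) = h a.
Proof.
elim: p a => //= b p IH a; rewrite /epath /= => /andP[/asboolP ab /IH ->].
exact: (h_nonunit hE ab).
Qed.

Definition inherits x xi : Prop := exists a, left_end L a /\ carries a (G a) x xi.

(** Two left ends from which [x] is reached have the same level, hence lie on one track. Along it
    the forced values carry over, so both values at [x] come from the same left end by two paths
    without horizontal edges. *)
Lemma inherits_uniq x xi eta : inherits x xi -> inherits x eta -> xi = eta.
Proof.
move=> [a [la [p [hp lp ->]]]] [b [lb [q [hq lq ->]]]].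
have hab : h b = h a by rewrite -(nonunit_level hp) lp -lq (nonunit_level hq).
have [al [F [al0 tr]]] := track_ex latL la.
have [|n bE] := on_track latL hE tr lb; first by rewrite al0.
have := carries_track n tr; rewrite -bE al0 => -[r [hr lr ->]].
rewrite -[X in _ = transport _ X _ _]lr -transport_cat.
apply: (nonunit_path_indep latL g_rh) => //.
- exact: edge_vertex la.
- by rewrite /epath cat_path lr; apply/andP.
- by rewrite last_cat lr lp lq.
Qed.

Lemma inherits_ex x : vertices L x -> exists xi, inherits x xi.
Proof.
move=> vx; have [a [la [p hp lp]]] := conn_left_end latL hE dir1 cohL vx.
by exists (transport (step g 1) a p (G a)), a; split=> //; exists p.
Qed.

Lemma shift_equation_solvable : exists f : R[i] -> V, forall x y, edge L x y ->
  (1 + (y - x)) *: f x - (1 - (y - x)) *: f y = 2 *: (g y - g x).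
Proof.
have /choice[f hf] : forall x, exists xi, vertices L x -> inherits x xi.
  move=> x; have [vx|nvx] := pselect (vertices L x); last by exists 0.
  by have [xi hxi] := inherits_ex vx; exists xi.
have fl a : left_end L a -> f a = g (a + 1) - g a.
  move=> la; apply: (@inherits_uniq a); first exact/hf/(edge_vertex la).
  by exists a; split=> //; apply: carries_refl.
exists f => x y exy.
have [e1|e1] := eqVneq (y - x) 1.
  have yE : y = x + 1 by rewrite -e1 addrC subrK.
  have lx : left_end L x by rewrite /left_end -yE.
  by rewrite e1 (fl _ lx) -yE subrr scale0r subr0.
have [e2|e2] := eqVneq (y - x) (-1).
  have xE : x = y + 1 by rewrite -[1]opprK -e2 opprB addrC subrK.
  have ly : left_end L y by rewrite /left_end -xE; apply: edge_sym.
  rewrite e2 (fl _ ly) -xE subrr scale0r sub0r opprK.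
  linear_identity R[i] V [:: g x; g y].
  by repeat split; ring.
have vx := edge_vertex exy; have vy := edge_vertex (edge_sym exy).
have -> : f y = step g 1 x y (f x).
  apply: (@inherits_uniq y); first exact: hf.
  have [a [la c]] := hf x vx; exists a; split=> //; apply: carries_trans c _.
  exists [:: y]; split=> //; rewrite /epath /= andbT; apply/asboolP; by split.
have d0 : 1 - (y - x) != 0 by rewrite subr_eq0 eq_sym.
rewrite /step mul1r scalerA divff // scale1r opprB addrC subrK.
by [].
Qed.

End Solve.

(** At a left end the equation reads [2 *: f a = 0]; along other edges the factor [1 - e] is
    nonzero, so zeros propagate to every vertex. *)
Lemma shift_kernel (f : R[i] -> V) : edge_directions L 1 ->
  coherent_tracks_on_both_sides L ->
  (forall x y, edge L x y -> (1 + (y - x)) *: f x = (1 - (y - x)) *: f y) ->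
  forall x, vertices L x -> f x = 0.
Proof.
move=> dir1 cohL hf x vx; have [h hE] := level_ex latL.
have [a [la [p hp <-]]] := conn_left_end latL hE dir1 cohL vx.
have : f a = 0.
  have := hf _ _ la; rewrite addlK subrr scale0r => /eqP.
  by rewrite scaler_eq0 (_ : 1 + 1 = 2%:R) // pnatr_eq0 /= => /eqP.
elim: p a hp {la} => //= b p IH a; rewrite /epath /= => /andP[/asboolP[e n1 n2] hp] fa.
apply: IH => //; have /eqP := hf _ _ e; rewrite fa scaler0 eq_sym scaler_eq0.
by rewrite subr_eq0 eq_sym (negbTE n1) /= => /eqP.
Qed.

Definition potential (f F : R[i] -> V) : Prop := forall x y, edge L x y ->
  F y - F x = (y - x) *: (2^-1 *: (f x + f y)).

(** Adding the trapezoidal increments is a transport, and the rhombus relation makes it flat. *)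
Lemma potential_ex f : rhombic_DA f -> exists F, potential f F.
Proof.
move=> rf.
have [A LA _] := lat_cover latL 0; have [a [u [v hA]]] := lat_rh latL LA.
have va : vertices L a by exists A => //; exists u, v.
have [||F [_ hF]] := @global_section _ L latL V
    (fun x y xi => xi + (y - x) *: (2^-1 *: (f x + f y))) _ _ a 0 va.
- move=> x y xi _; linear_identity R[i] V [:: xi; f x; f y].
  by repeat split; field.
- move=> B b x y xi LB hB; rewrite !addlK (_ : b + x + y - (b + y) = x); last by ring.
  apply: (lincomb1 (k := 2^-1) (rf _ _ _ _ LB hB)).
  linear_identity R[i] V [:: xi; f b; f (b + x); f (b + y); f (b + x + y)].
  by repeat split; field.
- exists F => x y exy; rewrite (hF _ _ exy).
  by rewrite addrAC subrr add0r.
Qed.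

Implicit Types (i j k : vertices L) (ps : seq (vertices L)).

(** Extension by 0 passes from functions on the subtype of vertices to functions on the plane, as
    used above. *)
Definition extend (f : vertices L -> V) (x : R[i]) : V := oapp f 0 (insub x).

Lemma extendE f i : extend f (val i) = f i.
Proof. by rewrite /extend valK. Qed.

Lemma lift_path i (p : seq R[i]) : epath (edge L) (val i) p -> exists2 ps,
  map val ps = p & path (fun j k => `[< @adjacent R L j k >]) i ps.
Proof.
elim: p i => [|x p IH] i; first by exists [::].
rewrite /epath /= => /andP[/asboolP ix hp].
pose j : vertices L := exist _ x (mem_set (edge_vertex (edge_sym ix))).
have [ps psE hps] := IH j hp.
exists (j :: ps) => /=; first by rewrite psE.
by rewrite hps andbT; apply/asboolP.
Qed.

Lemma path_ex i j : exists ps, path_from_to (@adjacent R L) i ps j.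
Proof.
have [p hp lp] := lattice_conn latL (set_mem (valP i)) (set_mem (valP j)).
have [ps psE hps] := lift_path hp; exists ps; split=> //.
by apply: val_inj; rewrite -last_map psE.
Qed.

Lemma potential_integral f F i ps j : potential (extend f) F ->
  path_from_to (@adjacent R L) i ps j -> path_integral f i ps = F (val j) - F (val i).
Proof.
move=> hF [hp <-]; elim: ps i hp => [|k ps IH] i /=; first by rewrite subrr.
move=> /andP[/asboolP ik /IH ->].
rewrite -[f i]extendE -[f k]extendE -(hF _ _ ik).
by rewrite addrC addrA subrK.
Qed.

Lemma potential_DA f F : potential (extend f) F -> discrete_analytic f.
Proof. by move=> hF i ps /(potential_integral hF) ->; rewrite subrr. Qed.

Lemma integralE f F i j : potential (extend f) F -> integral f i j = F (val j) - F (val i).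
Proof.
move=> hF; rewrite /integral; case: xgetP => [_ -> [ps hps ->]|none].
  exact: potential_integral hps.
(* Connectedness excludes the default value of [xget]. *)
have [ps hps] := path_ex i j.
by case: (none (path_integral f i ps)); exists ps.
Qed.

Lemma DA_rhombic f : discrete_analytic f -> rhombic_DA (extend f).
Proof.
move=> DA A a u v LA hA.
have [e1 e2 e3 e4] := rh_edges LA hA.
have va := edge_vertex e1; have vu := edge_vertex e3; have vv := edge_vertex e4.
have vuv := edge_vertex (edge_sym e3).
pose i0 : vertices L := exist _ a (mem_set va).
pose i1 : vertices L := exist _ (a + u) (mem_set vu).
pose i2 : vertices L := exist _ (a + v) (mem_set vv).
pose i3 : vertices L := exist _ (a + u + v) (mem_set vuv).
have cl : path_from_to (@adjacent R L) i0 [:: i1; i3; i2; i0] i0.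
  by split=> //=; rewrite andbT; apply/and4P; split; apply/asboolP => //; apply: edge_sym.
rewrite -[a]/(val i0) -[val i0 + u]/(val i1) -[val i0 + v]/(val i2) -[val i1 + v]/(val i3) !extendE.
have := DA _ _ cl; rewrite /= => E.
apply: (lincomb1 (k := 2) E).
rewrite addr0 !addlK (_ : a + v - (a + u + v) = - u); last by ring.
rewrite (_ : a - (a + v) = - v); last by ring.
linear_identity R[i] V [:: f i0; f i1; f i2; f i3].
by repeat split; field.
Qed.

Section ForwardShift.
Variable o : vertices L.
Variables (f : vertices L -> V) (F : R[i] -> V).
Hypothesis hF : potential (extend f) F.

Lemma forward_shiftE i :
  forward_shift o f i = 2^-1 *: (f o - f i) + (F (val i) - F (val o)).
Proof. by rewrite /forward_shift (integralE _ _ hF). Qed.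

Lemma forward_shift0 : forward_shift o f o = 0.
Proof. by rewrite forward_shiftE !subrr scaler0 addr0. Qed.

Lemma forward_shift_edge i j : edge L (val i) (val j) ->
  2 *: (forward_shift o f j - forward_shift o f i) =
  (1 + (val j - val i)) *: f i - (1 - (val j - val i)) *: f j.
Proof.
move=> e; rewrite !forward_shiftE; have := hF e; rewrite !extendE => E.
apply: (lincomb1 (k := 2) E).
linear_identity R[i] V [:: f o; f i; f j; F (val o); F (val i); F (val j)].
by repeat split; field.
Qed.

(** Expressing [F] at the corners through its value at [i0] leaves a multiple of the rhombus
    relation for [f]. *)
Lemma forward_shift_rhombic : rhombic_DA (extend (forward_shift o f)).
Proof.
move=> A a u v LA hA.
have [e1 e2 e3 e4] := rh_edges LA hA.
have va := edge_vertex e1; have vu := edge_vertex e3; have vv := edge_vertex e4.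
have vuv := edge_vertex (edge_sym e3).
pose i0 : vertices L := exist _ a (mem_set va).
pose i1 : vertices L := exist _ (a + u) (mem_set vu).
pose i2 : vertices L := exist _ (a + v) (mem_set vv).
pose i3 : vertices L := exist _ (a + u + v) (mem_set vuv).
have R0 := DA_rhombic (potential_DA hF) LA hA.
have E1 := hF e1; have E2 := hF e2; have E3 := hF e3.
rewrite addlK in E1; rewrite addlK in E2; rewrite addlK in E3.
move: R0 E1 E2 E3.
rewrite -[a]/(val i0) -[val i0 + u]/(val i1) -[val i0 + v]/(val i2) -[val i1 + v]/(val i3).
rewrite !extendE !forward_shiftE => R0 E1 E2 E3.
have F1 : F (val i1) = F (val i0) + u *: (2^-1 *: (f i0 + f i1)) by rewrite -E1 addrC subrK.
have F2 : F (val i2) = F (val i0) + v *: (2^-1 *: (f i0 + f i2)) by rewrite -E2 addrC subrK.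
have F3 : F (val i3) = F (val i1) + v *: (2^-1 *: (f i1 + f i3)) by rewrite -E3 addrC subrK.
rewrite F3 F2 F1; apply: (lincomb1 (k := (v - 1) / 2) R0).
linear_identity R[i] V [:: f o; f i0; f i1; f i2; f i3; F (val o); F (val i0)].
by repeat split; field.
Qed.

End ForwardShift.

End Shift.

Theorem theorem1p8 (R : realType) (V : lmodType R[i]) (L : set (set R[i]))
    (latL : rhombic_lattice L)
    (o : vertices L) (o0 : val o = 0)
    (dir1 : edge_directions L 1)
    (cohL : coherent_tracks_on_both_sides L) :
  [set f : vertices L -> V | DA_functions f /\ forward_shift o f = (fun=> 0)]
    = [set (fun=> 0)] /\
  forward_shift o @` @DA_functions R L V
    = [set f : vertices L -> V | DA_functions f /\ f o = 0].
Proof.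
have pot (f : vertices L -> V) : discrete_analytic f -> exists F, potential L (extend f) F.
  by move=> /DA_rhombic; apply: potential_ex.
split; apply/seteqP; split.
- move=> f [/pot[F hF] f0] /=; apply/funext => i.
  rewrite -(extendE f); apply: (shift_kernel latL dir1 cohL); last exact: set_mem (valP i).
  move=> x y exy; pose j : vertices L := exist _ x (mem_set (edge_vertex exy)).
  pose k : vertices L := exist _ y (mem_set (edge_vertex (edge_sym exy))).
  have := forward_shift_edge latL o hF (i := j) (j := k) exy.
  rewrite f0 subrr scaler0 -[x]/(val j) -[y]/(val k) !extendE => /esym/eqP.
  by rewrite subr_eq0 => /eqP.
- move=> _ ->.
  have h0 : potential L (extend (fun _ : vertices L => 0 : V)) (fun=> 0).
    move=> x y _; rewrite (_ : extend _ = fun=> 0) ?subrr ?addr0 ?scaler0 //.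
    by apply/funext => z; rewrite /extend; case: insub.
  split; first exact: potential_DA h0.
  by apply/funext => i; rewrite (forward_shiftE latL o h0) !subrr scaler0 addr0.
- move=> _ [f /pot[F hF] <-]; split; last exact: (forward_shift0 latL o hF).
  (* The rhombus relation gives the shift a primitive, which makes it discrete analytic. *)
  have [H hH] := potential_ex latL (forward_shift_rhombic latL o hF).
  exact: potential_DA hH.
- move=> g [DAg g0].
  have [h hE] := level_ex latL.
  have [f hf] := shift_equation_solvable latL (DA_rhombic DAg) dir1 cohL hE.
  pose f' (i : vertices L) := f (val i).
  (* The edge equation says that [F] is a primitive of [f']. In the shift computed with [F] the
     terms with [f] cancel and [g - g o] remains. *)
  pose F x := extend g x + 2^-1 *: f x.
  have hF : potential L (extend f') F.
    move=> x y exy; pose j : vertices L := exist _ x (mem_set (edge_vertex exy)).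
    pose k : vertices L := exist _ y (mem_set (edge_vertex (edge_sym exy))).
    have -> : extend f' x = f x by rewrite -[x]/(val j) extendE.
    have -> : extend f' y = f y by rewrite -[y]/(val k) extendE.
    rewrite /F; apply: (lincomb1 (k := - 2^-1) (hf _ _ exy)).
    linear_identity R[i] V [:: f x; f y; extend g x; extend g y].
    by repeat split; field.
  exists f'; first exact: potential_DA hF.
  apply/funext => i; rewrite (forward_shiftE latL o hF) /F !extendE g0 /f'.
  linear_identity R[i] V [:: g i; f (val i); f (val o)].
  by repeat split; ring.
Qed.
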